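(* Let $V$ be a Euclidean Jordan algebra of rank $r$ with unit $u$, equipped with the order-unit norm $\|\cdot\|_u$, and let $\overline{V}^h$ be the horofunction compactification of $(V,\|\cdot\|_u)$ with basepoint $0$. Let $h$ and $h'$ be horofunctions given by $$h(x)=\max\Big\{\Lambda_{V(p_I)}\Big(-U_{p_I}x-\sum_{i\in I}\alpha_ip_i\Big),\ \Lambda_{V(p_J)}\Big(U_{p_J}x-\sum_{j\in J}\alpha_jp_j\Big)\Big\}$$ and $$h'(x)=\max\Big\{\Lambda_{V(q_{I'})}\Big(-U_{q_{I'}}x-\sum_{i\in I'}\beta_iq_i\Big),\ \Lambda_{V(q_{J'})}\Big(U_{q_{J'}}x-\sum_{j\in J'}\beta_jq_j\Big)\Big\},$$ where $p_1,\dots,p_r$ and $q_1,\dots,q_r$ are Jordan frames, $I,J\subseteq\{1,\dots,r\}$ are disjoint with $I\cup J\ne\emptyset$, $I',J'\subseteq\{1,\dots,r\}$ are disjoint with $I'\cup J'\neq\emptyset$, and $\alpha\in\mathbb{R}^{I\cup J}$, $\beta\in\mathbb{R}^{I'\cup J'}$ satisfy $\min_k\alpha_k=0=\min_k\beta_k$ (a term with empty index set is omitted from the maximum). Then: (i) $h$ and $h'$ are in the same part if and only if $p_I=q_{I'}$ and $p_J=q_{J'}$. (ii) If $h$ and $h'$ are in the same part, then $\delta(h,h')=\|a-b\|_{\mathrm{var}}$, where $a=\sum_{i\in I}\alpha_ip_i+\sum_{j\in J}\alpha_jp_j$ and $b=\sum_{i\in I'}\beta_iq_i+\sum_{j\in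 J'}\beta_jq_j$ in $V(p_I,p_J)$. (iii) The part $(\mathcal{P}_h,\delta)$ is isometric to $(V(p_I,p_J)/\mathbb{R}p_{IJ},\|\cdot\|_{\mathrm{var}})$.
   Context: Euclidean Jordan algebra: a finite dimensional real Jordan algebra $(V,\bullet)$ with unit $u$ and an inner product for which every $L_x\colon y\mapsto x\bullet y$ is self-adjoint. Its cone is $V_+=\{x^2\colon x\in V\}$, inducing the order $x\le y\iff y-x\in V_+$, and $\|x\|_u=\inf\{\lambda\ge0\colon-\lambda u\le x\le\lambda u\}=\max\{|\lambda|\colon\lambda\in\sigma(x)\}$. A Jordan frame is a set $p_1,\dots,p_r$ of mutually orthogonal primitive idempotents with $p_1+\dots+p_r=u$, where $r$ is the rank. The quadratic representation is $U_xy=2x\bullet(x\bullet y)-x^2\bullet y$. For $I\subseteq\{1,\dots,r\}$ write $p_I=\sum_{i\in I}p_i$ (with $p_\emptyset=0$) and $V(p_I)=U_{p_I}(V)=\{x\in V\colon p_I\bullet x=x\}$, a subalgebra with unit $p_I$; $\Lambda_{V(p_I)}(z)$ is the maximal eigenvalue of $z\in V(p_I)$ in $V(p_I)$. For orthogonal idempotents $p_I,p_J$ let $V(p_I,p_J)=V(p_I)+V(p_J)$, a subalgebra with unit $p_{IJ}=p_I+p_J$, and for $x\in V(p_I,p_J)$ let $\|x\|_{\mathrm{var}}=\Lambda_{V(p_I,p_J)}(x)+\Lambda_{V(p_I,p_J)}(-x)=\mathrm{diam}\,\sigma_{V(p_I,p_J)}(x)$, where $\Lambda_{V(p_I,p_J)}$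 and $\sigma_{V(p_I,p_J)}$ denote maximal eigenvalue and spectrum in $V(p_I,p_J)$. This is a semi-norm on $V(p_I,p_J)$ and a norm on $V(p_I,p_J)/\mathbb{R}p_{IJ}$. Horofunctions and parts: with $h_y(z)=\|z-y\|_u-\|y\|_u$, $\overline{V}^h$ is the closure of $\{h_y\colon y\in V\}$ in $\mathbb{R}^V$ (pointwise convergence); horofunctions are the elements of $\overline{V}^h\setminus\{h_y\colon y\in V\}$. All functions $V\to\mathbb{R}$ of the form $$x\mapsto\max\Big\{\Lambda_{V(p_I)}\Big(-U_{p_I}x-\sum_{i\in I}\alpha_ip_i\Big),\ \Lambda_{V(p_J)}\Big(U_{p_J}x-\sum_{j\in J}\alpha_jp_j\Big)\Big\},$$ where $p_1,\dots,p_r$ is a Jordan frame, $I,J\subseteq\{1,\dots,r\}$ are disjoint with $I\cup J\neq\emptyset$, and $\alpha\in\mathbb{R}^{I\cup J}$ satisfies $\min_{k\in I\cup J}\alpha_k=0$ (a term with empty index set is omitted from the maximum), are horofunctions, every horofunction is of this form, and all are Busemann points (limits of $h_{x^\alpha}$ along almost geodesic nets $(x^\alpha)$). The detour cost is $H(h,h')=\sup_W\inf_{x\colon h_x\in W}(\|x\|_u+h'(x))$, with $W$ ranging over the neighbourhoods of $h$ in $\overline{V}^h$, and $\delta(h,h')=H(h,h')+H(h',h)$ is the detour distance. Two horofunctions are in the same part if $\delta(h,h')<\infty$; $\mathcal{P}_h$ is the part of $h$. *)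

(* Defs.v *)
From HB Require Import structures.
From mathcomp Require Export all_boot all_order all_algebra.
From mathcomp Require Export boolp classical_sets functions reals ereal.
From mathcomp Require Export topology normedtype.

Set Implicit Arguments.
Unset Strict Implicit.
Unset Printing Implicit Defensive.

Import Order.TTheory GRing.Theory Num.Theory.
Import numFieldNormedType.Exports.

Local Open Scope classical_set_scope.
Local Open Scope ring_scope.

(* The finite dimension of [V] is part of [vectType]. *)
Record euclidean_jordan_algebra (R : realType) (V : vectType R) :=
  EuclideanJordanAlgebra {
    jmul : V -> V -> V;
    jone : V;
    jdot : V -> V -> R;
    jmulC : forall x y, jmul x y = jmul y x;
    jmulDr : forall x y z, jmul x (y + z) = jmul x y + jmul x z;
    jmulZr : forall (a : R) x y, jmul x (a *: y) = a *: jmul x y;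
    jmul_jordan : forall x y,
      jmul x (jmul (jmul x x) y) = jmul (jmul x x) (jmul x y);
    jmul1x : forall x, jmul jone x = x;
    jdotC : forall x y, jdot x y = jdot y x;
    jdotDr : forall x y z, jdot x (y + z) = jdot x y + jdot x z;
    jdotZr : forall (a : R) x y, jdot x (a *: y) = a * jdot x y;
    jdot_gt0 : forall x, x != 0 -> 0 < jdot x x;
    jdot_self_adjoint : forall x y z,
      jdot (jmul x y) z = jdot y (jmul x z) }.

Section EuclideanJordan.
Context (R : realType) (V : vectType R) (A : euclidean_jordan_algebra V).
Implicit Types (x y z e p : V).

Local Notation "x • y" := (jmul A x y) (at level 40, left associativity).
Local Notation u := (jone A).

(* Powers and polynomial evaluation in a subalgebra whose unit is the
   idempotent [e]; they are meaningful when [e • x = x]. *)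
Definition jpow e x (k : nat) : V := iter k (jmul A x) e.

Definition jeval e (c : {poly R}) x : V :=
  \sum_(k < size c) c`_k *: jpow e x k.

(* The rank is the maximal degree of a minimal polynomial, that is, the largest
   [r] such that u, x, ..., x^(r-1) are linearly independent for some [x]. *)
Definition has_rank (r : nat) : Prop :=
  (exists x, free [seq jpow u x k | k <- iota 0 r]) /\
  (forall x, ~~ free [seq jpow u x k | k <- iota 0 r.+1]).

Definition idempotent_elt p : Prop := p • p = p.

Definition primitive_idempotent p : Prop :=
  [/\ idempotent_elt p, p <> 0 &
      forall c d, idempotent_elt c -> idempotent_elt d -> c • d = 0 ->
        p = c + d -> c = 0 \/ d = 0].

Definition jordan_frame (r : nat) (p : 'I_r -> V) : Prop :=
  [/\ forall i, primitive_idempotent (p i),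
      forall i j, i != j -> p i • p j = 0 &
      \sum_(i < r) p i = u].

Definition frame_sum (r : nat) (p : 'I_r -> V) (I : {set 'I_r}) : V :=
  \sum_(i in I) p i.

(* The quadratic representation U_x. *)
Definition Uquad x y : V := 2%:R *: (x • (x • y)) - (x • x) • y.

Definition jle x y : Prop := exists z, y - x = z • z.

Definition unorm x : R :=
  inf [set l : R | 0 <= l /\ jle (- (l *: u)) x /\ jle x (l *: u)].

(* [x] is invertible in a subalgebra with unit [e] when it has an inverse in
   the associative subalgebra R[x] generated by [x] and [e]. *)
Definition jinvertible e x : Prop := exists c : {poly R}, x • jeval e c x = e.

(* Spectrum and maximal eigenvalue in a subalgebra with unit [e]. The spectrum
   is finite, and nonempty if [e <> 0], so that the supremum is a maximum. *)
Definition spectrum e x : set R := [set l | ~ jinvertible e (l *: e - x)].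

Definition maxeig e x : R := sup (spectrum e x).

Definition peirce1 p : set V := range (Uquad p).

Definition peirce_sum p q : set V :=
  [set x + y | x in peirce1 p & y in peirce1 q].

Definition varnorm e x : R := maxeig e x + maxeig e (- x).

(* V(p, q) / R(p + q), as the set of cosets, with the quotient of the
   semi-norm [varnorm (p + q)]. *)
Definition line_coset e x : set V := [set x + t *: e | t in [set: R]].

Definition quot_space p q : set (set V) :=
  [set line_coset (p + q) x | x in peirce_sum p q].

Definition quot_varnorm e (C : set V) : R := inf [set varnorm e x | x in C].

Definition quot_vardist e (C D : set V) : R :=
  quot_varnorm e [set x - y | x in C & y in D].

(* Horofunction compactification with basepoint 0. *)
Definition hpoint y : {ptws V -> R} := fun z => unorm (z - y) - unorm y.

Definition horo_compactification : set {ptws V -> R} := closure (range hpoint).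

Definition horofunction : set {ptws V -> R} :=
  horo_compactification `\` range hpoint.

Definition detour_cost (h h' : {ptws V -> R}) : \bar R :=
  ereal_sup [set ereal_inf [set (unorm x + h' x)%:E | x in hpoint @^-1` W]
            | W in within horo_compactification (nbhs h)].

Definition detour_dist (h h' : {ptws V -> R}) : \bar R :=
  (detour_cost h h' + detour_cost h' h)%E.

Definition same_part (h h' : {ptws V -> R}) : Prop :=
  (detour_dist h h' < +oo)%E.

Definition part_of (h : {ptws V -> R}) : set {ptws V -> R} :=
  [set g | horofunction g /\ same_part h g].

Definition weighted_sum (r : nat) (p : 'I_r -> V) (alpha : 'I_r -> R)
  (I : {set 'I_r}) : V := \sum_(i in I) alpha i *: p i.

(* Only the values of [alpha] on the index set [K] matter. *)
Definition min_zero_on (r : nat) (alpha : 'I_r -> R) (K : {set 'I_r}) : Prop :=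
  (forall k, k \in K -> 0 <= alpha k) /\ (exists2 k, k \in K & alpha k = 0).

Definition horo_form (r : nat) (p : 'I_r -> V) (I J : {set 'I_r})
    (alpha : 'I_r -> R) : {ptws V -> R} :=
  fun x =>
  let tI := maxeig (frame_sum p I)
              (- Uquad (frame_sum p I) x - weighted_sum p alpha I) in
  let tJ := maxeig (frame_sum p J)
              (Uquad (frame_sum p J) x - weighted_sum p alpha J) in
  if I == finset.set0 then tJ
  else if J == finset.set0 then tI
  else Num.max tI tJ.

End EuclideanJordan.

(* [f] maps (X, dX) isometrically onto (Y, dY); [dX] may take infinite values
   outside X. *)
Definition isometric (R : realType) (S T : Type)
    (X : set S) (dX : S -> S -> \bar R) (Y : set T) (dY : T -> T -> R) : Prop :=
  exists2 f : S -> T, set_bij X Y f &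
    forall x y, X x -> X y -> dX x y = (dY (f x) (f y))%:E.

(* Main.v *)
From HB Require Import structures.
Require Import Defs.
From mathcomp Require Import complex ring lra.

Set Implicit Arguments.
Unset Strict Implicit.
Unset Printing Implicit Defensive.

Import Order.TTheory GRing.Theory Num.Theory.
Import numFieldNormedType.Exports.

Local Open Scope ring_scope.

(* A horofunction of the given form is determined by a pair of orthogonal
   idempotents p, q and an element a of V(p, q): g z <= t means that
   t p + U_p (z + a) and t q - U_q (z - a) lie in the cone of squares. Along
   y_s = s (p - q) - U_p a + U_q a one has ||y_s|| = s + o(1) and h_{y_s} -> g,
   while a second such function g' with data (p, q, b) takes the value
   -s + Lambda (a - b) at y_s; as g' is 1-Lipschitz, H(g, g') = Lambda (a - b).
   If the pairs (p, q) and (p', q') differ, comparing the two functions along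
   s (p - q) and s (p' - q') makes one of the detour costs infinite.

   That every horofunction g has this form is shown with an ultrafilter G on V
   along which h_y -> g. Here ||y|| tends to infinity, and the eigenvalues of
   ||y|| u + y either stay bounded along G or tend to infinity; q and U_q a are
   the limits of the spectral projection onto the bounded ones and of the
   corresponding part of ||y|| u + y. The same applied to ||y|| u - y gives p
   and U_p a. *)

(** * Jordan algebra identities *)

(** Eigenvalue bounds are handled as cone membership: [maxeig_le] turns Lambda(x) <= t into
    [pos (t *: e - x)], and self-duality of the cone ([posP]) turns that into inequalities <x, v²>
    >= 0 accessible to linear arithmetic. This also avoids a default value: for e = 0 the spectrum
    is empty and [maxeig] is 0, so a vanishing p or q would add a spurious 0 to a maximum of two
    eigenvalues. The obstacle is the way back from the corners V(p), V(q) to V. Positivity of U_q z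
    says nothing about the other Peirce components of z; adding eps u and a large multiple of u - q
    repairs this ([pos_corner_penalty]). That estimate gives both h_{y_s} -> g and one half of the
    classification. In the classification, an eigenvalue is bounded along G or tends to infinity
    because the spectral projections on [0, M] have dimensions bounded by dim V, so along G they
    stop growing at some M0 ([cut_stable]). *)

Lemma real_poly_factor (R : realType) (f : {poly R}) : (1 < size f)%N ->
  (exists a g, f = ('X - a%:P) * g) \/
  (exists a b g, b != 0 /\ f = (('X - a%:P) ^+ 2 + (b ^+ 2)%:P) * g).
Proof.
move=> sf; have /closed_rootP[z] : size (map_poly (real_complex R) f) != 1%N.
  by rewrite size_map_poly; case: size sf => [|[]].
case: z => a b; have [->|b0] := eqVneq b 0.
  rewrite -[Complex a 0]/(real_complex R a) fmorph_root => /factor_theorem[g ->].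
  by left; exists a, g; rewrite mulrC.
move=> rz; right; exists a, b; pose m := ('X - a%:P) ^+ 2 + (b ^+ 2)%:P.
have sm : size m = 3%N.
  rewrite size_polyDl ?size_exp_XsubC //.
  by rewrite size_polyC; case: (_ != 0).
have mz : (map_poly (real_complex R) m).[Complex a b] = 0.
  rewrite rmorphD rmorphXn rmorphB /= map_polyX !map_polyC /= !hornerE.
  by apply/eqP; rewrite eq_complex /= expr2 /=; apply/andP; split; apply/eqP; ring.
exists (divp f m); split => //; rewrite mulrC {1}(divp_eq f m) -/m.
suff -> : modp f m = 0 by rewrite addr0.
have : (size (modp f m) < 3)%N by rewrite -sm ltn_modp -size_poly_gt0 sm.
move: rz; rewrite {1}(divp_eq f m) rmorphD rmorphM /root hornerD hornerM mz.
rewrite mulr0 add0r; set r := modp f m => rz; rewrite ltnS => sr.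
have Er : r = (r`_0)%:P + (r`_1)%:P * 'X.
  apply/polyP => -[|[|i]]; rewrite coefD coefC coefMX /= ?coefC ?addr0 ?add0r //.
  by rewrite nth_default //; apply: leq_trans sr _.
move: rz; rewrite {1}Er rmorphD rmorphM /= map_polyX !map_polyC /= !hornerE.
rewrite eq_complex /= => /andP[/eqP h0 /eqP h1].
have r1 : r`_1 = 0.
  by apply: (mulIf b0); rewrite mul0r; move: h1; rewrite mul0r; lra.
have r0 : r`_0 = 0 by move: h0; rewrite r1; lra.
by rewrite Er r0 r1 !polyC0 mul0r addr0.
Qed.

Section JordanAlgebra.
Context (R : realType) (V : vectType R) (A : euclidean_jordan_algebra V).
Implicit Types (x y z w e c p q v : V) (s t : R).

Local Notation "x • y" := (jmul A x y) (at level 40, left associativity).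
Local Notation u := (jone A).
Local Notation "<| x , y |>" := (jdot A x y) (at level 0, x, y at level 99).

Lemma jmulDl x y z : (x + y) • z = x • z + y • z.
Proof. by rewrite jmulC jmulDr !(jmulC A z). Qed.

Lemma jmulZl s x y : (s *: x) • y = s *: (x • y).
Proof. by rewrite jmulC jmulZr jmulC. Qed.

Lemma jmulx0 x : x • 0 = 0.
Proof. by rewrite -(scale0r (0 : V)) jmulZr !scale0r. Qed.

Lemma jmul0x x : 0 • x = 0.
Proof. by rewrite jmulC jmulx0. Qed.

Lemma jmulNr x y : x • (- y) = - (x • y).
Proof. by rewrite -scaleN1r jmulZr scaleN1r. Qed.

Lemma jmulNl x y : (- x) • y = - (x • y).
Proof. by rewrite jmulC jmulNr jmulC. Qed.

Lemma jmul_sumr I (r : seq I) (P : pred I) (F : I -> V) x :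
  x • (\sum_(i <- r | P i) F i) = \sum_(i <- r | P i) x • F i.
Proof. by apply: big_morph => [y z|]; rewrite (jmulDr, jmulx0). Qed.

Lemma jmul_suml I (r : seq I) (P : pred I) (F : I -> V) x :
  (\sum_(i <- r | P i) F i) • x = \sum_(i <- r | P i) F i • x.
Proof. by rewrite jmulC jmul_sumr; apply: eq_bigr => i _; rewrite jmulC. Qed.

Lemma jmulx1 x : x • u = x.
Proof. by rewrite jmulC jmul1x. Qed.

Lemma jdotDl x y z : <|x + y, z|> = <|x, z|> + <|y, z|>.
Proof. by rewrite jdotC jdotDr !(jdotC A z). Qed.

Lemma jdotZl s x y : <|s *: x, y|> = s * <|x, y|>.
Proof. by rewrite jdotC jdotZr jdotC. Qed.

Lemma jdotx0 x : <|x, 0|> = 0.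
Proof. by rewrite -(scale0r (0 : V)) jdotZr mul0r. Qed.

Lemma jdot0x x : <|0, x|> = 0.
Proof. by rewrite jdotC jdotx0. Qed.

Lemma jdotNr x y : <|x, - y|> = - <|x, y|>.
Proof. by rewrite -scaleN1r jdotZr mulN1r. Qed.

Lemma jdotNl x y : <|- x, y|> = - <|x, y|>.
Proof. by rewrite jdotC jdotNr jdotC. Qed.

Lemma jdot_suml I (r : seq I) (P : pred I) (F : I -> V) x :
  <|\sum_(i <- r | P i) F i, x|> = \sum_(i <- r | P i) <|F i, x|>.
Proof.
by apply: (big_morph (fun y => <|y, x|>)) => [y z|]; rewrite (jdotDl, jdot0x).
Qed.

Definition jmulE := (jmulDl, jmulDr, jmulNl, jmulNr, jmulZl, jmulZr, jmul0x,
  jmulx0, jmul1x, jmulx1).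

Definition jdotE := (jdotDl, jdotDr, jdotNl, jdotNr, jdotZl, jdotZr, jdot0x,
  jdotx0).

Lemma jdot_inj x y : (forall w, <|x, w|> = <|y, w|>) -> x = y.
Proof.
move=> h; apply/eqP; rewrite -subr_eq0; apply/negPn/negP => /(jdot_gt0 A).
by rewrite jdotDl jdotNl h subrr ltxx.
Qed.

(* Identities in V are checked against test vectors, where [ring] applies. *)
Local Ltac lin := apply: jdot_inj => ?; rewrite ?jdotE; ring.

Lemma jdot_ge0 x : 0 <= <|x, x|>.
Proof. by have [->|/(jdot_gt0 A)/ltW//] := eqVneq x 0; rewrite jdotx0. Qed.

Lemma jdot_eq0 x : <|x, x|> = 0 -> x = 0.
Proof.
by move=> h; apply/eqP/negPn/negP => /(jdot_gt0 A); rewrite h ltxx.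
Qed.

Lemma jdot_jmul x y z : <|x • y, z|> = <|y, x • z|>.
Proof. exact: jdot_self_adjoint. Qed.

Lemma jdot_jmulA x y z : <|x • y, z|> = <|x, y • z|>.
Proof. by rewrite jmulC jdot_jmul. Qed.

(** Full polarization of the Jordan identity: [J] is cubic in [a], and inclusion-exclusion over x,
    z, w isolates the part linear in each, which occurs twice by commutativity. *)
Lemma jordan_linearized x z w y :
  x • ((z • w) • y) + z • ((x • w) • y) + w • ((x • z) • y) =
  (z • w) • (x • y) + (x • w) • (z • y) + (x • z) • (w • y).
Proof.
pose J a := a • ((a • a) • y) - (a • a) • (a • y).
have J0 a : J a = 0 by rewrite /J jmul_jordan subrr.
have : J (x + z + w) - J (x + z) - J (x + w) - J (z + w) + J x + J z + J w = 0.
  by rewrite !J0; lin.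
rewrite /J !jmulE (jmulC A z x) (jmulC A w x) (jmulC A w z) => h.
have {}h v := congr1 (jdot A ^~ v) h.
apply: jdot_inj => v; have {h} := h v; rewrite !jdotE; lra.
Qed.

(** The linearized identity read as an operator in [w] instead of [y]: it expresses L_{(xz)y}
    through products of the simpler multiplications, and so drives inductions on powers. *)
Lemma jmul_jmulE x z y w :
  ((x • z) • y) • w = (x • y) • (z • w) + (z • y) • (x • w) +
    (x • z) • (y • w) - x • (y • (z • w)) - z • (y • (x • w)).
Proof.
have /(congr1 (jdot A ^~ _)) h := jordan_linearized x z w y.
apply: jdot_inj => v; have {h} := h v.
rewrite (jmulC A w y) (jmulC A (z • w) y) (jmulC A (x • w) y) (jmulC A w).
rewrite (jmulC A (x • y)) (jmulC A (z • y)) !jdotE; lra.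
Qed.

(** * Peirce decomposition with respect to an idempotent *)

Section Idempotent.
Context (e : V) (ee : e • e = e).

(** With L = L_e this is L (2L - 1) (L - 1) = 0, which confines the eigenvalues of L to 0, 1/2 and
    1. *)
Lemma idem_cubic x :
  2 *: (e • (e • (e • x))) = 3 *: (e • (e • x)) - e • x.
Proof.
have /(congr1 (jdot A ^~ _)) h := jmul_jmulE e e e x.
apply: jdot_inj => v; have {h} := h v; rewrite !ee !jdotE; lra.
Qed.

Lemma peirce_decomp x : exists x1 xh x0,
  [/\ x = x1 + xh + x0, e • x1 = x1, e • xh = 2^-1 *: xh & e • x0 = 0].
Proof.
have := idem_cubic x; set a := e • x; set b := e • a => h.
have h3 : e • b = (3 / 2) *: b - 2^-1 *: a.
  apply: (scalerI (_ : 2 != 0 :> R)); first by rewrite pnatr_eq0.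
  have {}h v := congr1 (jdot A ^~ v) h.
  apply: jdot_inj => v; move: (h v); rewrite !jdotE; lra.
(* Lagrange interpolation at the eigenvalues 1, 1/2, 0 of L_e; the first component is
   [Uquad A e x]. *)
exists (2%:R *: b - a), (4%:R *: (a - b)), (x - 3%:R *: a + 2%:R *: b).
split; rewrite ?jmulE -?/a -?/b ?h3; apply: jdot_inj => v; rewrite !jdotE; lra.
Qed.

Lemma UquadE x : Uquad A e x = 2%:R *: (e • (e • x)) - e • x.
Proof. by rewrite /Uquad ee. Qed.

Lemma Uquad_decomp x1 xh x0 : e • x1 = x1 -> e • xh = 2^-1 *: xh ->
  e • x0 = 0 -> Uquad A e (x1 + xh + x0) = x1.
Proof.
move=> h1 hh h0; rewrite UquadE !jmulDr h1 hh h0 h1 jmulx0 !jmulE hh.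
apply: jdot_inj => v; rewrite !jdotE; lra.
Qed.

Lemma jmul_Uquad x : e • Uquad A e x = Uquad A e x.
Proof.
have [x1 [xh [x0 [-> h1 hh h0]]]] := peirce_decomp x.
by rewrite Uquad_decomp.
Qed.

Lemma Uquad_id x : e • x = x -> Uquad A e x = x.
Proof. by move=> h; rewrite UquadE !h; lin. Qed.

Lemma Uquad_eq0 x : e • x = 0 -> Uquad A e x = 0.
Proof. by move=> h; rewrite UquadE !h jmulx0; lin. Qed.

Lemma Uquad_selfadj x y : <|Uquad A e x, y|> = <|x, Uquad A e y|>.
Proof. by rewrite !UquadE !jdotE !jdot_jmul. Qed.

(** Put two of the three variables of the linearized identity equal to [e]: for eigenvalue 1 or 0 of
    [a] it collapses to commutation of L_e and L_a, whereas for 1/2 it becomes trivial. *)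
Lemma peirce_commute a x : e • a = a \/ e • a = 0 ->
  e • (a • x) = a • (e • x).
Proof.
have /(congr1 (jdot A ^~ _)) h := jordan_linearized a e e x.
case=> ea; apply: jdot_inj => v; have {h} := h v;
  rewrite (jmulC A a e) ea ee ?jmul0x ?jmulx0 !jdotE; lra.
Qed.

(** By commutation L_e both kills and fixes the product. *)
Lemma peirce10 a b : e • a = a -> e • b = 0 -> a • b = 0.
Proof.
move=> ha hb.
have := peirce_commute b (or_introl ha); rewrite hb jmulx0 => h1.
have := peirce_commute a (or_intror hb); rewrite ha => h2.
by rewrite jmulC -h2 jmulC (jmulC A b) jmulC.
Qed.

Lemma peirce11 a b : e • a = a -> e • b = b -> e • (a • b) = a • b.
Proof. by move=> ha hb; rewrite peirce_commute ?hb //; left. Qed.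

Lemma idem_compl : (u - e) • (u - e) = u - e.
Proof. by rewrite !jmulE ee; lin. Qed.

End Idempotent.

Lemma UquadD e x y : Uquad A e (x + y) = Uquad A e x + Uquad A e y.
Proof. by rewrite /Uquad !jmulE; lin. Qed.

Lemma UquadZ e s x : Uquad A e (s *: x) = s *: Uquad A e x.
Proof. by rewrite /Uquad !jmulE; lin. Qed.

Lemma UquadN e x : Uquad A e (- x) = - Uquad A e x.
Proof. by rewrite /Uquad !jmulE; lin. Qed.

Lemma Uquad0 x : Uquad A 0 x = 0.
Proof. by rewrite /Uquad !jmulE; lin. Qed.

Lemma UquadB e x y : Uquad A e (x - y) = Uquad A e x - Uquad A e y.
Proof. by rewrite UquadD UquadN. Qed.

Lemma Uquadx0 e : Uquad A e 0 = 0.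
Proof. by rewrite /Uquad !jmulx0 scaler0 subr0. Qed.

Lemma Uquad1 e : e • e = e -> Uquad A e u = e.
Proof. by move=> ee; rewrite UquadE // jmulx1 ee; lin. Qed.

Definition UquadL := (UquadD, UquadN, UquadZ).

(** * Polynomials in one element and eigen-idempotents *)

Section PolynomialCalculus.
Context (e x : V) (ee : e • e = e) (ex : e • x = x).

Lemma jevalE n (f : {poly R}) : (size f <= n)%N ->
  jeval A e f x = \sum_(k < n) f`_k *: jpow A e x k.
Proof.
move=> sn; rewrite /jeval.
rewrite (big_ord_widen _ (fun k => f`_k *: jpow A e x k) sn) big_mkcond /=.
apply: eq_bigr => k _; case: ltnP => // /(nth_default 0) ->.
by rewrite scale0r.
Qed.

Lemma jevalD f g : jeval A e (f + g) x = jeval A e f x + jeval A e g x.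
Proof.
pose n := maxn (size f) (size g).
rewrite (@jevalE n (f + g)) ?size_polyD // (@jevalE n f) ?leq_maxl //.
rewrite (@jevalE n g) ?leq_maxr // -big_split /=.
by apply: eq_bigr => k _; rewrite coefD scalerDl.
Qed.

Lemma jevalZ s f : jeval A e (s *: f) x = s *: jeval A e f x.
Proof.
rewrite (@jevalE (size f) (s *: f)) ?size_scale_leq // /jeval scaler_sumr.
by apply: eq_bigr => k _; rewrite coefZ scalerA.
Qed.

Lemma jevalXM f : jeval A e ('X * f) x = x • jeval A e f x.
Proof.
rewrite (@jevalE (size f).+1); last first.
  by rewrite (leq_trans (size_polyMleq _ _)) ?size_polyX.
rewrite big_ord_recl coefXM /= scale0r add0r /jeval jmul_sumr.
by apply: eq_bigr => k _; rewrite /bump /= coefXM /= jmulZr.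
Qed.

Lemma jevalC s : jeval A e s%:P x = s *: e.
Proof.
rewrite (@jevalE 1) ?size_polyC_leq1 // big_ord_recl big_ord0 addr0.
by rewrite coefC.
Qed.

Lemma jevalXsubCM s f :
  jeval A e (('X - s%:P) * f) x = x • jeval A e f x - s *: jeval A e f x.
Proof.
by rewrite mulrBl jevalD jevalXM -mulNr -polyCN mul_polyC jevalZ scaleNr.
Qed.

Lemma annihilating_poly : exists2 f, f != 0 & jeval A e f x = 0.
Proof.
pose n := (\dim {:V}).+1.
pose X := [tuple jpow A e x i | i < n].
have : ~~ free X.
  apply/negP => /eqP h; have := dimvS (subvf <<X>>).
  by rewrite h size_tuple ltnn.
move/freeP => h.
have [k [kX [i ki]]] : exists k : 'I_n -> R,
    \sum_(i < n) k i *: X`_i = 0 /\ exists i, k i <> 0.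
  apply: contrapT => nk; apply: h => k kX i; apply: contrapT => ki.
  by apply: nk; exists k; split => //; exists i.
pose f := \poly_(j < n) k (inord j).
have fE (j : 'I_n) : f`_j = k j by rewrite coef_poly ltn_ord inord_val.
exists f; first by apply/eqP => f0; apply: ki; rewrite -fE f0 coef0.
rewrite (@jevalE n) ?size_poly // -[RHS]kX; apply: eq_bigr => j _.
by rewrite fE -tnth_nth tnth_mktuple.
Qed.

Lemma jeval_mulV1 f : e • jeval A e f x = jeval A e f x.
Proof.
rewrite /jeval jmul_sumr; apply: eq_bigr => k _; rewrite jmulZr; congr (_ *: _).
by elim: (nat_of_ord k) => //= m IH; rewrite peirce11.
Qed.

(** Descent on the degree of an annihilating polynomial. Removing a linear factor X - a either still
    annihilates or leaves an eigenvector. A factor (X - a)² + b² can always be removed: on w = g(x)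
    it would give |(L_x - a) w|² + b² |w|² = 0 by self-adjointness of L_x. *)
Lemma jeval_eigenvector : e != 0 -> exists s f,
  jeval A e f x != 0 /\ x • jeval A e f x = s *: jeval A e f x.
Proof.
move=> e0; have [f f0 fx] := annihilating_poly.
elim: {f}(size f) {-2}f (leqnn (size f)) f0 fx => [|n IH] f.
  by rewrite size_poly_leq0 => ->.
move=> sf f0 fx; have sf1 : (1 < size f)%N.
  rewrite ltnNge; apply/negP => /size1_polyC fC; move: fx f0.
  rewrite fC jevalC polyC_eq0 => /eqP; rewrite scaler_eq0 (negbTE e0) orbF.
  by move=> ->.
have [[a [g fE]]|[a [b [g [b0 fE]]]]] := real_poly_factor sf1.
- have g0 : g != 0 by apply: contraNneq f0 => g0; rewrite fE g0 mulr0.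
  have [gx|gx] := eqVneq (jeval A e g x) 0.
    apply: IH gx => //; rewrite -ltnS (leq_trans _ sf) // fE.
    by rewrite size_mul ?polyXsubC_eq0 // size_XsubC.
  exists a, g; split => //; apply/eqP; rewrite -subr_eq0.
  by rewrite -jevalXsubCM -fE fx.
- have g0 : g != 0 by apply: contraNneq f0 => g0; rewrite fE g0 mulr0.
  set m := _ + _ in fE; have sm : size m = 3%N.
    rewrite size_polyDl ?size_exp_XsubC //.
    by rewrite size_polyC; case: (_ != 0).
  have [gx|gx] := eqVneq (jeval A e g x) 0.
    apply: IH gx => //; rewrite -ltnS (leq_trans _ sf) // fE.
    have m0 : m != 0 by rewrite -size_poly_gt0 sm.
    by rewrite size_mul // sm ltnW.
  have := fx; rewrite fE mulrDl expr2 -mulrA jevalD jevalXsubCM mul_polyC jevalZ.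
  rewrite jevalXsubCM; set w := jeval A e g x => /(congr1 (jdot A ^~ w)).
  have h1 := jdot_ge0 (x • w - a *: w); have := jdot_gt0 A gx; rewrite -/w.
  move: h1; rewrite !jmulE !jdotE !jdot_jmul => h1 h2 h3.
  have : 0 < b ^+ 2 * <|w, w|> by rewrite mulr_gt0 // exprn_even_gt0.
  have := jdotC A (x • w) w; rewrite jdot_jmul; lra.
Qed.

(** No power associativity is available yet. The case k = 2 uses that [w] is a polynomial in [x],
    with the Jordan identity moving x² past each power; larger k follow from [jmul_jmulE] applied to
    x, x^k, x. *)
Lemma jpow_eigen s f k (w := jeval A e f x) : x • w = s *: w ->
  jpow A e x k • w = s ^+ k *: w.
Proof.
move=> xw; have e_w : e • w = w by exact: jeval_mulV1.
have xe : x • e = x by rewrite jmulC.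
have xxw : (x • x) • w = s ^+ 2 *: w.
  transitivity (x • (x • w)); last by rewrite xw jmulZr xw scalerA.
  rewrite /w /jeval !jmul_sumr; apply: eq_bigr => j _; rewrite !jmulZr.
  congr (_ *: _); elim: (nat_of_ord j) => /= [|m IH]; last first.
    by rewrite -jmul_jordan IH.
  by rewrite xe jmulC peirce11.
elim: k {-2}k (leqnn k) => [|n IH] [|[|k]] // kn; rewrite /= ?xe ?e_w ?scale1r //.
have IHk := IH k (ltnW kn); have /= IHk1 := IH k.+1 kn.
have := jmul_jmulE x (jpow A e x k) x w.
rewrite (jmulC A (x • _) x) (jmulC A (jpow A e x k) x) 
  !(xw, xxw, IHk, IHk1, jmulZr).
by move=> ->; apply: jdot_inj => v; rewrite !jdotE !exprS; ring.
Qed.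

(** The eigenvector w = f(x) satisfies w² = f(s) w, so w / f(s) is idempotent. If f(s) = 0, then <w,
    w> = <e, w²> = 0. *)
Lemma idempotent_eigen : e != 0 -> exists s c,
  [/\ c != 0, c • c = c, e • c = c & x • c = s *: c].
Proof.
case/jeval_eigenvector => s [f []]; set w := jeval A e f x => w0 xw.
have e_w : e • w = w by exact: jeval_mulV1.
have ww : w • w = f.[s] *: w.
  rewrite {1}/w /jeval jmul_suml horner_coef scaler_suml.
  by apply: eq_bigr => k _; rewrite jmulZl (@jpow_eigen s f k xw) scalerA.
have fs0 : f.[s] != 0.
  apply/eqP => fs0; move: w0; rewrite (_ : w = 0) ?eqxx //; apply: jdot_eq0.
  by rewrite -{1}e_w (jmulC A e) jdot_jmul ww fs0 scale0r jdotx0.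
exists s, (f.[s]^-1 *: w); rewrite !jmulE xw ww e_w; split => //.
- by rewrite scaler_eq0 invr_eq0 (negbTE fs0).
- by rewrite [f.[s]^-1 *: (f.[s] *: w)]scalerA mulVf ?scale1r.
- by rewrite !scalerA mulrC.
Qed.

End PolynomialCalculus.

End JordanAlgebra.

(** * The spectral theorem *)

Section SpectralTheorem.
Context (R : realType) (V : vectType R) (A : euclidean_jordan_algebra V).
Implicit Types (x y z w e c p q v : V) (s t : R).

Local Notation "x • y" := (jmul A x y) (at level 40, left associativity).
Local Notation u := (jone A).
Local Notation "<| x , y |>" := (jdot A x y) (at level 0, x, y at level 99).
Local Ltac lin := apply: (jdot_inj (A := A)) => ?; rewrite ?jdotE; ring.

HB.instance Definition _ x := GRing.isLinear.Build R V V *:%R (jmul A x)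
  (fun (s : R) y z => etrans (jmulDr A x (s *: y) z)
     (congr1 (+%R^~ (x • z)) (jmulZr A s x y))).

Definition peirce1_space e : {vspace V} := fixedSpace (linfun (jmul A e)).

Lemma peirce1_spaceP e x : reflect (e • x = x) (x \in peirce1_space e).
Proof. by apply: (iffP fixedSpaceP); rewrite lfunE. Qed.

Section SubIdempotent.
Context (e c : V) (ee : e • e = e) (cc : c • c = c) (ec : e • c = c).

Lemma subidem_compl : (e - c) • (e - c) = e - c.
Proof. by rewrite !jmulE ee cc ec (jmulC A c e) ec; lin. Qed.

Lemma subidem_orth : (e - c) • c = 0.
Proof. by rewrite !jmulE ec cc subrr. Qed.

Lemma jmul_subidem x : c • x = x -> e • x = x.
Proof.
move=> cx; have h : (e - c) • x = 0.
  by rewrite jmulC (peirce10 cc) // jmulC subidem_orth.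
by apply/eqP; rewrite -subr_eq0 -{2}cx -jmulNl -jmulDl h.
Qed.

End SubIdempotent.

Lemma peirce1_dim_le e c : e • e = e -> c • c = c -> e • c = c ->
  (peirce1_space c <= peirce1_space e)%VS.
Proof.
move=> ee cc ec; apply/subvP => x /peirce1_spaceP cx; apply/peirce1_spaceP.
exact: (@jmul_subidem e c).
Qed.

Lemma peirce1_dim_eq e c : e • e = e -> c • c = c -> e • c = c ->
  (\dim (peirce1_space e) <= \dim (peirce1_space c))%N -> e = c.
Proof.
move=> ee cc ec hd; have := peirce1_dim_le ee cc ec.
move=> /dimv_leqif_eq[le1]; rewrite eqn_leq le1 hd => /esym/eqP E.
have /peirce1_spaceP : e \in peirce1_space c by rewrite E; apply/peirce1_spaceP.
by rewrite jmulC ec.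
Qed.

Definition resolution e n (c : 'I_n -> V) : Prop :=
  [/\ forall i, c i • c i = c i, forall i, c i != 0,
      forall i j, i != j -> c i • c j = 0 & \sum_(i < n) c i = e].

(** Induction on dim V(e): an eigen-idempotent [c] is split off and x - s c lies in the smaller V(e
    - c). The resulting idempotents may be imprimitive and the eigenvalues may repeat, which does
    not affect spectra. *)
Theorem spectral_theorem e x : e • e = e -> e • x = x ->
  exists n (l : 'I_n -> R) (c : 'I_n -> V),
    resolution e c /\ x = \sum_(i < n) l i *: c i.
Proof.
have [n] := ubnP (\dim (peirce1_space e)); elim: n => // n IH in e x *.
move=> dn ee ex; have [e0|e0] := eqVneq e 0.
  exists 0, (fun _ => 0), (fun _ => 0); split; last first.
    by rewrite big_ord0 -ex e0 jmul0x.
  by split; [case| case| case| rewrite big_ord0 e0].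
have [s [c [c0 cc ec xc]]] := idempotent_eigen ee ex e0.
have e'e' := subidem_compl ee cc ec; have e'c := subidem_orth cc ec.
have e'e : e • (e - c) = e - c by rewrite jmulDr jmulNr ee ec.
have [|//||m [l [d [[dd d0 dij sd] xd]]]] := IH (e - c) (x - s *: c).
- rewrite -ltnS (leq_trans _ dn) // ltnS ltnNge; apply/negP.
  move=> /(peirce1_dim_eq ee e'e' e'e) E; move: e'c; rewrite -E ec.
  by move/eqP; rewrite (negbTE c0).
- by rewrite !jmulE ex ec (jmulC A c x) xc cc; lin.
have dc i : d i • c = 0.
  rewrite jmulC (peirce10 cc) // jmulC.
  have dE : (e - c) • d i = d i.
    rewrite -sd jmul_suml (bigD1 i) //= big1 ?addr0 // => j; exact: dij.
  by rewrite (peirce10 e'e').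
pose ext T (a : T) (f : 'I_m -> T) (i : 'I_m.+1) :=
  if unlift ord0 i is Some j then f j else a.
exists m.+1, (ext R s l), (ext V c d); split; last first.
  rewrite big_ord_recl /ext unlift_none; under eq_bigr do rewrite liftK.
  by rewrite -xd addrC subrK.
split=> [i|i|i j|].
- by rewrite /ext; case: unliftP.
- by rewrite /ext; case: unliftP.
- rewrite /ext; case: unliftP => [i' ->|->]; case: unliftP => [j' ->|->] //.
  + by rewrite (inj_eq lift_inj); apply: dij.
  + by rewrite jmulC.
- rewrite big_ord_recl /ext unlift_none; under eq_bigr do rewrite liftK.
  by rewrite sd addrC subrK.
Qed.

Section Resolution.
Context (e : V) (n : nat) (c : 'I_n -> V) (re : resolution e c).

Lemma resolution_mulr (a : 'I_n -> R) j :
  (\sum_(i < n) a i *: c i) • c j = a j *: c j.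
Proof.
case: re => cc _ cij _; rewrite jmul_suml (bigD1 j) //= jmulZl cc.
by rewrite big1 ?addr0 // => i ij; rewrite jmulZl cij // scaler0.
Qed.

Lemma resolution_mul (a b : 'I_n -> R) :
  (\sum_(i < n) a i *: c i) • (\sum_(i < n) b i *: c i) =
  \sum_(i < n) (a i * b i) *: c i.
Proof.
rewrite jmul_sumr; apply: eq_bigr => i _.
by rewrite jmulZr resolution_mulr scalerA mulrC.
Qed.

Lemma resolution_unit : e = \sum_(i < n) 1 *: c i.
Proof. by case: re => _ _ _ <-; apply: eq_bigr => i _; rewrite scale1r. Qed.

Lemma resolution_addl (a : 'I_n -> R) t :
  t *: e + \sum_(i < n) a i *: c i = \sum_(i < n) (t + a i) *: c i.
Proof.
rewrite {1}resolution_unit scaler_sumr -big_split /=.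
by apply: eq_bigr => i _; rewrite scale1r scalerDl.
Qed.

Lemma resolution_subl (a : 'I_n -> R) t :
  t *: e - \sum_(i < n) a i *: c i = \sum_(i < n) (t - a i) *: c i.
Proof.
by rewrite -resolution_addl -sumrN; under [in RHS]eq_bigr do rewrite scaleNr.
Qed.

Lemma resolution_mulV1 j : e • c j = c j.
Proof. by rewrite resolution_unit resolution_mulr scale1r. Qed.

Lemma resolution_dot (a : 'I_n -> R) j :
  <|\sum_(i < n) a i *: c i, c j|> = a j * <|c j, c j|>.
Proof.
case: re => cc _ _ _.
by rewrite -{1}(cc j) -jdot_jmulA resolution_mulr jdotZl.
Qed.

Lemma resolution_dot_gt0 j : 0 < <|c j, c j|>.
Proof. by case: re => _ c0 _ _; apply: jdot_gt0. Qed.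

Lemma resolution_jeval (a : 'I_n -> R) (f : {poly R}) :
  jeval A e f (\sum_(i < n) a i *: c i) = \sum_(i < n) f.[a i] *: c i.
Proof.
have E k : jpow A e (\sum_(i < n) a i *: c i) k = \sum_(i < n) a i ^+ k *: c i.
  elim: k => [|k IH]; first exact: resolution_unit.
  transitivity ((\sum_(i < n) a i *: c i) •
    jpow A e (\sum_(i < n) a i *: c i) k) => //.
  rewrite IH resolution_mul.
  by apply: eq_bigr => i _; rewrite exprS.
rewrite /jeval; under eq_bigr do rewrite E scaler_sumr.
rewrite exchange_big /=; apply: eq_bigr => i _.
by rewrite horner_coef scaler_suml; apply: eq_bigr => k _; rewrite scalerA.
Qed.

Lemma spectrum_resolution (a : 'I_n -> R) :
  spectrum A e (\sum_(i < n) a i *: c i) = range a.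
Proof.
apply/seteqP; split => t; rewrite /spectrum /= /jinvertible resolution_subl.
- move=> ninv; apply: contrapT => nt; apply: ninv.
  pose f : {poly R} := \prod_(i < n) ('X - (t - a i)%:P).
  have f0 : f.[0] != 0.
    rewrite /f horner_prod; apply/prodf_neq0 => i _.
    rewrite hornerXsubC sub0r oppr_eq0 subr_eq0; apply/eqP => ta.
    by apply: nt; exists i.
  (* With [f] vanishing at all eigenvalues t - a_i and f(0) nonzero, 1 - f / f(0) is divisible by X;
     the quotient takes the value 1 / (t - a_i) at t - a_i, so it is the inverse. *)
  have /factor_theorem[g gE] : root (1 - f.[0]^-1 *: f) 0.
    by rewrite /root !hornerE mulVf // subrr.
  exists g; rewrite resolution_jeval resolution_mul resolution_unit.
  apply: eq_bigr => i _; congr (_ *: _).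
  have := congr1 (horner ^~ (t - a i)) gE; rewrite !hornerE.
  rewrite (_ : f.[t - a i] = 0) ?mulr0 ?subr0; first by move=> ->; rewrite mulrC.
  by rewrite /f horner_prod (bigD1 i) //= hornerXsubC subrr mul0r.
- case=> i _ <- [f]; rewrite resolution_jeval resolution_mul.
  move/(congr1 (fun x => x • c i)); rewrite resolution_mulr subrr mul0r scale0r.
  rewrite resolution_mulV1 => /esym/eqP.
  by case: re => _ c0 _ _; rewrite (negbTE (c0 i)).
Qed.

Lemma maxeig_resolution (a : 'I_n -> R) t : e != 0 ->
  maxeig A e (\sum_(i < n) a i *: c i) <= t <-> forall i, a i <= t.
Proof.
move=> e0; rewrite /maxeig spectrum_resolution; split=> [at_ i|ha].
  apply: le_trans at_; apply: ub_le_sup; last by exists i.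
  exists (\sum_(i < n) `|a i|) => _ [j _ <-].
  rewrite (bigD1 j) //= (le_trans (ler_norm _)) // lerDl.
  by rewrite sumr_ge0.
apply: ge_sup => [|_ [i _ <-]//].
case: n c re a ha => [|m] d [_ _ _ sd] a _; last by exists (a ord0), ord0.
by move: e0; rewrite -sd big_ord0 eqxx.
Qed.

End Resolution.

End SpectralTheorem.

(** * The cone of squares *)

Section ConeOfSquares.
Context (R : realType) (V : vectType R) (A : euclidean_jordan_algebra V).
Implicit Types (x y z w e c p q v : V) (s t : R).

Local Notation "x • y" := (jmul A x y) (at level 40, left associativity).
Local Notation u := (jone A).
Local Notation "<| x , y |>" := (jdot A x y) (at level 0, x, y at level 99).
Local Ltac lin := apply: (jdot_inj (A := A)) => ?; rewrite ?jdotE; ring.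

Definition pos x := exists z, x = z • z.

Lemma jleP x y : jle A x y <-> pos (y - x).
Proof. by []. Qed.

(** The Peirce components are orthogonal. The constant 1/2 is the smaller of the eigenvalues 1/2 and
    1 of u - e on the components left in v - a. *)
Lemma idem_dot_bounds e v (a := Uquad A e v) : e • e = e ->
  [/\ 2^-1 * <|v - a, v - a|> <= <|(u - e) • (v - a), v - a|>,
      0 <= <|e • v, v|>, <|e • v, v|> = 0 -> e • v = 0 & e • a = a].
Proof.
move=> ee; rewrite /a; have [x1 [xh [x0 [-> h1 hh h0]]]] := peirce_decomp ee v.
rewrite Uquad_decomp //.
have o1h : <|x1, xh|> = 0.
  by have := jdot_jmul A e x1 xh; rewrite h1 hh jdotZr; lra.
have o10 : <|x1, x0|> = 0.
  by have := jdot_jmul A e x1 x0; rewrite h1 h0 jdotx0.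
have oh0 : <|xh, x0|> = 0.
  by have := jdot_jmul A e xh x0; rewrite hh h0 jdotx0 jdotZl; lra.
have := jdot_ge0 A x1; have := jdot_ge0 A xh; have := jdot_ge0 A x0.
rewrite !jmulE h1 hh h0 !jdotE (jdotC A xh x1) (jdotC A x0 x1) (jdotC A x0 xh).
rewrite o1h o10 oh0 => p0 ph p1; split=> //; [lra|lra|move=> z].
have [z1 zh] : <|x1, x1|> = 0 /\ <|xh, xh|> = 0 by split; lra.
by rewrite (jdot_eq0 z1) (jdot_eq0 zh) scaler0 !addr0.
Qed.

Lemma pos_dot_idem x c : pos x -> c • c = c -> 0 <= <|x, c|>.
Proof.
move=> [z ->] cc; have [_ h _ _] := idem_dot_bounds z cc.
by rewrite jdot_jmul jdotC jmulC.
Qed.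

Lemma pos_resolution e n (c : 'I_n -> V) (l : 'I_n -> R) : resolution A e c ->
  (forall i, 0 <= l i) -> pos (\sum_(i < n) l i *: c i).
Proof.
move=> rc l0; exists (\sum_(i < n) Num.sqrt (l i) *: c i).
rewrite (resolution_mul rc); apply: eq_bigr => i _.
by rewrite -expr2 sqr_sqrtr.
Qed.

(** The coefficients of a spectral resolution inside V(e) are <x, c_i> / <c_i, c_i>, so only
    idempotents of V(e) need testing. *)
Lemma pos_peirce1 e x : e • e = e -> e • x = x ->
  (forall c, c • c = c -> e • c = c -> 0 <= <|x, c|>) -> pos x.
Proof.
move=> ee ex h; have [n [l [c [rc xE]]]] := spectral_theorem ee ex.
rewrite xE; apply: (pos_resolution rc) => i.
have := h (c i); rewrite xE (resolution_dot rc) pmulr_lge0; last first.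
  exact: resolution_dot_gt0 rc _.
by apply; [case: rc|exact: resolution_mulV1 rc _].
Qed.

Lemma one_idem : u • u = u. Proof. exact: jmul1x. Qed.

(** Self-duality of the cone. For a square x = z² and an idempotent c, <x, c> = <c z, z> >= 0; the
    spectral theorem for v passes from idempotents to all squares. *)
Lemma posP x : pos x <-> forall v, 0 <= <|x, v • v|>.
Proof.
split=> [px v|h].
  have [n [l [c [rc ->]]]] := spectral_theorem one_idem (jmul1x A v).
  rewrite (resolution_mul rc) jdotC jdot_suml sumr_ge0 // => i _.
  rewrite jdotZl mulr_ge0 -?expr2 ?sqr_ge0 // jdotC pos_dot_idem //.
  by case: rc.
by apply: (pos_peirce1 one_idem) => [|c cc _]; rewrite ?jmul1x // -cc.
Qed.

Lemma pos_dot x y : pos x -> pos y -> 0 <= <|x, y|>.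
Proof. by move=> /posP h [z ->]. Qed.

Lemma pos_sqr x : pos (x • x). Proof. by exists x. Qed.

Lemma pos_idem c : c • c = c -> pos c.
Proof. by move=> cc; exists c. Qed.

Lemma pos0 : pos 0.
Proof. by exists 0; rewrite jmul0x. Qed.

Lemma posD x y : pos x -> pos y -> pos (x + y).
Proof.
by move=> /posP hx /posP hy; apply/posP => v; rewrite jdotDl addr_ge0.
Qed.

Lemma posZ s x : 0 <= s -> pos x -> pos (s *: x).
Proof. by move=> s0 /posP hx; apply/posP => v; rewrite jdotZl mulr_ge0. Qed.

Lemma pos_Uquad e x : e • e = e -> pos x -> pos (Uquad A e x).
Proof.
move=> ee px; apply: (pos_peirce1 ee) => [|c cc ec].
  exact: jmul_Uquad.
by rewrite (Uquad_selfadj ee) (Uquad_id ee) // pos_dot_idem.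
Qed.

Lemma pos_antisym x : pos x -> pos (- x) -> x = 0.
Proof.
move=> /posP p1 /posP p2.
have h c : c • c = c -> <|x, c|> = 0.
  by move=> cc; have := p1 c; have := p2 c; rewrite cc jdotNl; lra.
have [n [l [c [rc xE]]]] := spectral_theorem one_idem (jmul1x A x).
apply: (@jdot_eq0 _ _ A); rewrite {1}xE jdot_suml big1 // => i _.
by rewrite jdotZl jdotC h ?mulr0 //; case: rc.
Qed.

Lemma pos_order_bound x :
  exists2 M, 0 <= M & pos (M *: u - x) /\ pos (M *: u + x).
Proof.
have [n [l [c [rc xE]]]] := spectral_theorem one_idem (jmul1x A x).
pose M := \sum_(i < n) `|l i|.
have lM i : `|l i| <= M.
  by rewrite /M (bigD1 i) //= lerDl sumr_ge0.
exists M; first exact: sumr_ge0.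
rewrite xE (resolution_subl rc) (resolution_addl rc).
split; apply: (pos_resolution rc) => i; have := lM i; rewrite ler_norml;
  by case/andP; lra.
Qed.

Lemma pos_archimedean x y : (forall eps, 0 < eps -> pos (x + eps *: y)) -> pos x.
Proof.
move=> h; apply/posP => v; rewrite leNgt; apply/negP => x0.
have [y0|y0] := lerP <|y, v • v|> 0.
  have /posP/(_ v) := h 1 ltr01; rewrite jdotDl scale1r; lra.
(* Chosen so that eps <y, v²> cancels exactly half of the negative number <x, v²>. *)
pose eps := - <|x, v • v|> / (2 * <|y, v • v|>).
have e0 : 0 < eps by rewrite divr_gt0 ?mulr_gt0 ?oppr_gt0.
have /posP/(_ v) := h eps e0.
rewrite jdotDl jdotZl {1}/eps invfM mulrA mulfVK ?gt_eqF //; lra.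
Qed.

Lemma idem_orth p q : p • p = p -> q • q = q -> <|p, q|> <= 0 -> q • p = 0.
Proof.
move=> pp qq pq; have [_ h0 h _] := idem_dot_bounds p qq; apply: h.
by apply/eqP; rewrite eq_le h0 andbT jdot_jmulA pp jdotC.
Qed.

Lemma maxeig_le e x t : e • e = e -> e • x = x -> e != 0 ->
  maxeig A e x <= t <-> pos (t *: e - x).
Proof.
move=> ee ex e0; have [n [l [c [rc xE]]]] := spectral_theorem ee ex.
rewrite xE (maxeig_resolution rc) // (resolution_subl rc); split=> [h|h i].
  by apply: (pos_resolution rc) => i; rewrite subr_ge0.
have := pos_dot_idem h (c := c i); rewrite (resolution_dot rc).
rewrite pmulr_lge0; last exact: resolution_dot_gt0 rc _.
by rewrite subr_ge0; apply; case: rc.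
Qed.

Lemma pos_scale_idem e t : e • e = e -> e != 0 -> pos (t *: e) -> 0 <= t.
Proof.
move=> ee e0 /pos_dot_idem /(_ ee); rewrite jdotZl pmulr_lge0 //.
exact: jdot_gt0.
Qed.

(** The infimum defining the norm is attained, at the larger of the maximal eigenvalues of x and
    -x. *)
Lemma unorm_le x t : u != 0 ->
  unorm A x <= t <-> pos (t *: u - x) /\ pos (t *: u + x).
Proof.
move=> u0; pose m := Num.max (maxeig A u x) (maxeig A u (- x)).
have mP s : m <= s <-> pos (s *: u - x) /\ pos (s *: u + x).
  have h1 := maxeig_le s one_idem (jmul1x A x) u0.
  have h2 := maxeig_le s one_idem (jmul1x A (- x)) u0.
  rewrite opprK in h2; rewrite /m ge_max; split=> [/andP[]|[]].
    by move=> /h1 ? /h2.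
  by move=> /h1 -> /h2 ->.
suff -> : unorm A x = m by [].
have SE : [set l : R | 0 <= l /\ jle A (- (l *: u)) x /\ jle A x (l *: u)]%classic
    = [set l | m <= l]%classic.
  apply/seteqP; split=> [s /= [_ []]|s /= /mP[p1 p2]].
    by rewrite !jleP opprK addrC => ? ?; apply/mP.
  rewrite !jleP opprK (addrC x); do 2?[split=> //].
  apply: (pos_scale_idem one_idem u0).
  rewrite (_ : s *: u = 2^-1 *: ((s *: u - x) + (s *: u + x))).
    by apply: posZ; [rewrite invr_ge0 ler0n|exact: posD].
  apply: (jdot_inj (A := A)) => w; rewrite !jdotE; lra.
rewrite /unorm SE; apply/eqP; rewrite eq_le; apply/andP; split.
  by apply: ge_inf => //=; exists m.
by apply: lb_le_inf => //; exists m => /=.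
Qed.

Lemma unorm_pos x : u != 0 ->
  pos (unorm A x *: u - x) /\ pos (unorm A x *: u + x).
Proof. by move=> u0; apply/unorm_le. Qed.

Lemma unorm_ge0 x : u != 0 -> 0 <= unorm A x.
Proof.
move=> u0; have [h1 h2] := unorm_pos x u0.
apply: (pos_scale_idem one_idem u0).
have := posZ (_ : 0 <= 2^-1) (posD h1 h2); rewrite invr_ge0 ler0n => /(_ isT).
by congr pos; apply: (jdot_inj (A := A)) => w; rewrite !jdotE; lra.
Qed.

(* For v = v1 + v' with v1 in V(q), the cross term of <z + m (u - q), v²> is
   controlled by Cauchy-Schwarz for the form <M u + z, v²>. *)
Lemma pos_corner_penalty q z eps : q • q = q -> pos (Uquad A q z) -> 0 < eps ->
  exists m0, forall m, m0 <= m -> pos (z + eps *: u + m *: (u - q)).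
Proof.
move=> qq pz eps0; have [M M0 [pMn pMp]] := pos_order_bound z.
(* The weight [d] of the Cauchy-Schwarz step satisfies 2 d M <= eps, so eps u absorbs the |v1|²
   share of the cross term; the 1 in the denominator covers M = 0. The |v'|² terms need m / 2 >= M +
   2 M / d, where 1/2 comes from [idem_dot_bounds]. *)
pose d := eps / (2 * M + 1); pose Md := M / d.
have M1 : 0 < 2 * M + 1 by lra.
have d0 : 0 < d by rewrite divr_gt0.
have dM : 2 * d * M <= eps.
  have : d * (2 * M + 1) = eps by rewrite /d mulfVK ?gt_eqF.
  lra.
have MdE : M = d * Md by rewrite /Md mulrC mulfVK ?gt_eqF.
exists (2 * M + 4 * Md) => m hm; apply/posP => v.
have [a [b [vE a1 ab hb]]] : exists a b, [/\ v = a + b, q • a = a,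
    <|a, b|> = 0 & 2^-1 * <|b, b|> <= <|(u - q) • b, b|>].
  exists (Uquad A q v), (v - Uquad A q v).
  have [hb _ _ a1] := idem_dot_bounds v qq; split=> //; first by rewrite subrKC.
  by rewrite jdotDr jdotNr -{1}(Uquad_id qq a1) (Uquad_selfadj qq) subrr.
have paa : 0 <= <|z, a • a|>.
  have aa : q • (a • a) = a • a by exact: peirce11.
  rewrite -[a • a](Uquad_id qq) // -(Uquad_selfadj qq).
  by apply: pos_dot pz (pos_sqr _).
have bb0 : 0 <= <|b, b|> := jdot_ge0 A b.
have aa0 : 0 <= <|a, a|> := jdot_ge0 A a.
have one x y : <|u, x • y|> = <|x, y|> by rewrite -jdot_jmulA jmul1x.
have qv : <|u - q, v • v|> = <|(u - q) • b, b|>.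
  have qa : (u - q) • a = 0 by rewrite !jmulE a1 subrr.
  rewrite vE -jdot_jmulA jmulDr qa add0r -[RHS]addr0 jdotDr addrC.
  by congr (_ + _); rewrite jdot_jmul qa jdotx0.
have cs : 0 <= <|M *: u + z, (d *: a + b) • (d *: a + b)|>.
  exact: pos_dot pMp (pos_sqr _).
have zb : <|z, b • b|> <= M * <|b, b|> /\ - (M * <|b, b|>) <= <|z, b • b|>.
  have := pos_dot pMn (pos_sqr b); have := pos_dot pMp (pos_sqr b).
  by rewrite !jdotE one; split; lra.
have za : <|z, a • a|> <= M * <|a, a|>.
  have := pos_dot pMn (pos_sqr a); rewrite !jdotE one; lra.
have hab : 0 <= 2 * d * M * <|a, a|> + 2 * <|z, a • b|> + 2 * Md * <|b, b|>.
  rewrite -(pmulr_rge0 _ d0); move: cs; rewrite !jmulE (jmulC A b a) !jdotE !one.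
  rewrite ab => cs; apply: le_trans cs _; have [zb1 _] := zb.
  have := ler_wpM2l (ltW d0) (ler_wpM2l (ltW d0) za).
  rewrite -subr_ge0 => za'; rewrite -subr_ge0.
  have : d * Md * <|b, b|> = M * <|b, b|> by rewrite -MdE.
  lra.
have haa := ler_wpM2r aa0 dM; have hbb := ler_wpM2r bb0 hm.
rewrite !jdotDl !jdotZl qv vE !jmulE (jmulC A b a) !jdotE !one ab.
have hm0 : 0 <= m.
  have : 0 <= Md by rewrite /Md divr_ge0 // ltW.
  lra.
have := ler_wpM2l hm0 hb; have := mulr_ge0 (ltW eps0) bb0.
case: zb => _ zb2; rewrite !jmulE !jdotE; lra.
Qed.
End ConeOfSquares.

(** * Horofunctions attached to a pair of orthogonal idempotents *)

Section Horofunctions.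
Context (R : realType) (V : vectType R) (A : euclidean_jordan_algebra V).
Implicit Types (x y z w e c p q v : V) (s t : R).

Local Notation "x • y" := (jmul A x y) (at level 40, left associativity).
Local Notation u := (jone A).
Local Notation "<| x , y |>" := (jdot A x y) (at level 0, x, y at level 99).
Local Ltac lin := apply: (jdot_inj (A := A)) => ?; rewrite ?jdotE; ring.

Section PointwiseTopology.
Local Open Scope classical_set_scope.

Lemma nbhs_ptws (T : choiceType) (g : {ptws T -> R}) (a : T) eps : 0 < eps ->
  nbhs g [set f : {ptws T -> R} | `|f a - g a| < eps].
Proof.
move=> e0; have := @proj_continuous T (fun _ => R) a g.
move=> /(_ (ball (g a) eps)) /(_ (nbhsx_ballx (g a) eps e0)) h.
have {}h : nbhs g [set f : {ptws T -> R} | ball (g a) eps (f a)] by exact: h.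
refine (@filterS _ (nbhs g) _ _ _ _ h) => f /=.
by rewrite -ball_normE /= distrC.
Qed.

Lemma cvg_ptws (T : choiceType) S (F : set_system S) (f : S -> {ptws T -> R})
    (g : {ptws T -> R}) : Filter F ->
  (forall a eps, 0 < eps -> F [set y | `|f y a - g a| < eps]) -> f @ F --> g.
Proof.
move=> FF h; apply/cvg_sup => a; apply/cvg_image.
  by rewrite eqEsubset; split => // y _; exists (cst y).
move=> W /= /nbhs_ballP[eps /= e0 sW]; exists (fun k : T -> R => W (k a)).
  refine (@filterS _ F _ _ _ _ (h a eps e0)) => y /= hy; apply: sW.
  by rewrite -ball_normE /= distrC.
by rewrite eqEsubset; split => [_ [k Wk <-]//|k Wk]; exists (cst k).
Qed.

End PointwiseTopology.

Lemma hpoint_at0 y : hpoint A y 0 = 0.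
Proof.
have -> : hpoint A y 0 = unorm A (- y) - unorm A y by rewrite /hpoint sub0r.
rewrite /unorm (_ : [set l | _]%classic = 
  [set l : R | 0 <= l /\ jle A (- (l *: u)) y /\ jle A y (l *: u)]%classic).
  by rewrite subrr.
by apply/seteqP; split=> l /= [l0]; rewrite !jleP !opprK => -[h1 h2];
  split=> //; split; rewrite addrC.
Qed.

Lemma horo_at0 (g : {ptws V -> R}) : horo_compactification A g -> g 0 = 0.
Proof.
move=> hg; apply/eqP/negPn/negP => g0.
have e0 : 0 < `|g 0| by rewrite normr_gt0.
have [_ [[y _ <-]]] := hg _ (nbhs_ptws g 0 e0).
by rewrite /= hpoint_at0 sub0r normrN ltxx.
Qed.

Section OrthogonalIdempotents.
Context (p q : V) (pp : p • p = p) (qq : q • q = q) (pq : p • q = 0).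

Let qp : q • p = 0. Proof. by rewrite jmulC. Qed.

Lemma orth_idemD : (p + q) • (p + q) = p + q.
Proof. by rewrite !jmulE pp qq pq qp addr0 add0r. Qed.

Lemma Uquad_orth x : Uquad A p (Uquad A q x) = 0.
Proof.
apply: (Uquad_eq0 pp); rewrite jmulC (peirce10 qq) //; exact: jmul_Uquad.
Qed.

Lemma jmul_orth_Uquad x : p • Uquad A q x = 0.
Proof. by rewrite jmulC (peirce10 qq) //; exact: jmul_Uquad. Qed.

End OrthogonalIdempotents.

(* The inequality [g z <= t] for the horofunction with data (p, q, a), written
   without eigenvalues so that [p = 0] or [q = 0] needs no separate treatment. *)
Definition horo_rel p q a (g : V -> R) : Prop := forall z t,
  g z <= t <-> pos A (t *: p + Uquad A p (z + a)) /\
               pos A (t *: q - Uquad A q (z - a)).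

Section HoroRel.
Context (p q : V) (pp : p • p = p) (qq : q • q = q) (pq : p • q = 0).

Let qp : q • p = 0. Proof. by rewrite jmulC. Qed.

(** The component of [a] in V(p) + V(q), the only part of the datum that [horo_rel] sees. *)
Definition block a := Uquad A p a + Uquad A q a.

Lemma block0 : block 0 = 0.
Proof. by rewrite /block !Uquadx0 addr0. Qed.

Lemma block_mul a : (p + q) • block a = block a.
Proof.
rewrite /block; have := jmul_Uquad pp a; have := jmul_Uquad qq a.
have := jmul_orth_Uquad qq pq a; have := jmul_orth_Uquad pp qp a.
move: (Uquad A p a) (Uquad A q a) => x y qx py qy px.
by rewrite !jmulE px py qx qy addr0 add0r.
Qed.

Lemma Uquadl_block a : Uquad A p (block a) = Uquad A p a.
Proof.
by rewrite UquadD (Uquad_orth pp qq pq) addr0 Uquad_id // jmul_Uquad.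
Qed.

Lemma Uquadr_block a : Uquad A q (block a) = Uquad A q a.
Proof.
by rewrite UquadD (Uquad_orth qq pp qp) add0r Uquad_id // jmul_Uquad.
Qed.

Lemma pos_block t a : pos A (t *: (p + q) - block a) <->
  pos A (t *: p - Uquad A p a) /\ pos A (t *: q - Uquad A q a).
Proof.
split=> [h|[h1 h2]]; last first.
  have := posD h1 h2; congr pos; rewrite /block; lin.
split; [have := pos_Uquad pp h|have := pos_Uquad qq h].
  rewrite UquadD UquadN Uquadl_block UquadZ UquadD.
  rewrite (Uquad_id pp pp) (Uquad_eq0 pp pq).
  by rewrite addr0.
rewrite UquadD UquadN Uquadr_block UquadZ UquadD.
rewrite (Uquad_id qq qq) (Uquad_eq0 qq qp).
by rewrite add0r.
Qed.

(* Along this path [hpoint] converges to the horofunction with data (p, q, a). *)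
Definition ray a s := s *: (p - q) - Uquad A p a + Uquad A q a.

Lemma Uquadl_ray a s : Uquad A p (ray a s) = s *: p - Uquad A p a.
Proof.
rewrite /ray; have := Uquad_orth pp qq pq a.
have := Uquad_id pp (jmul_Uquad pp a).
move: (Uquad A p a) (Uquad A q a) => x y px py.
by rewrite !UquadL px py (Uquad_id pp pp) (Uquad_eq0 pp pq) subr0 addr0.
Qed.

Lemma Uquadr_ray a s : Uquad A q (ray a s) = Uquad A q a - s *: q.
Proof.
rewrite /ray; have := Uquad_orth qq pp qp a.
have := Uquad_id qq (jmul_Uquad qq a).
move: (Uquad A p a) (Uquad A q a) => x y qy qx.
rewrite !UquadL qx qy (Uquad_id qq qq) (Uquad_eq0 qq qp).
by rewrite sub0r subr0 scalerN addrC.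
Qed.

Lemma horo_ray a b g s : p + q != 0 -> horo_rel p q b g ->
  g (ray a s) = maxeig A (p + q) (block (a - b)) - s.
Proof.
move=> pq0 hg; have P t : g (ray a s) <= t <->
    maxeig A (p + q) (block (a - b)) <= t + s.
  apply: (iff_trans (hg _ _)); apply: (iff_trans _ (iff_sym (maxeig_le _ _ _ _)));
    rewrite ?orth_idemD ?block_mul //.
  apply: (iff_trans _ (iff_sym (pos_block _ _))).
  rewrite UquadD Uquadl_ray !UquadB Uquadr_ray.
  rewrite (_ : t *: p + _ = (t + s) *: p - (Uquad A p a - Uquad A p b)); last lin.
  rewrite (_ : t *: q - _ = (t + s) *: q - (Uquad A q a - Uquad A q b)); last lin.
  exact: iff_refl.
apply/eqP; rewrite eq_le; apply/andP; split; first by apply/P; rewrite subrK.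
by rewrite lerBlDr; apply/P.
Qed.

Context (u0 : u != 0).

Lemma horo_shift_le a g z s t : horo_rel p q a g ->
  unorm A (z - ray a s) <= t -> g z <= t - s.
Proof.
move=> hg /(unorm_le _ _ u0)[/(pos_Uquad qq) h1 /(pos_Uquad pp) h2].
have E1 : Uquad A q (t *: u - (z - ray a s)) = (t - s) *: q - Uquad A q (z - a).
  rewrite !UquadB Uquadr_ray UquadZ (Uquad1 qq); lin.
have E2 : Uquad A p (t *: u + (z - ray a s)) = (t - s) *: p + Uquad A p (z + a).
  rewrite !UquadD UquadN Uquadl_ray UquadZ (Uquad1 pp); lin.
by apply/hg; rewrite -E1 -E2.
Qed.

(** The relation at t = g z controls only the two corners. Along the ray, t u - (z - y_s) contains s
    (u - q) + s p, and t u + (z - y_s) contains s (u - p) + s q: one summand is the penalty that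
    lifts the corner bound to V, the other is positive. *)
Lemma horo_shift_ge a g z eps : horo_rel p q a g -> 0 < eps ->
  exists s0, forall s, s0 <= s -> unorm A (z - ray a s) <= g z + s + eps.
Proof.
move=> hg e0; have [h2 h1] := (hg z (g z)).1 (lexx _).
pose w := Uquad A q a - Uquad A p a.
have wq : Uquad A q w = Uquad A q a.
  rewrite /w UquadB (Uquad_orth qq pp qp) subr0 Uquad_id //.
  exact: jmul_Uquad.
have wp : Uquad A p w = - Uquad A p a.
  rewrite /w UquadB (Uquad_orth pp qq pq) sub0r Uquad_id //.
  exact: jmul_Uquad.
have Eq : Uquad A q (g z *: u - z + w) = g z *: q - Uquad A q (z - a).
  rewrite (UquadD A q _ w) wq !UquadB UquadZ (Uquad1 qq); lin.
have Ep : Uquad A p (g z *: u + z - w) = g z *: p + Uquad A p (z + a).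
  rewrite (UquadB A p _ w) wp !UquadD UquadZ (Uquad1 pp); lin.
rewrite -Eq in h1; rewrite -Ep in h2.
have [s1 hs1] := pos_corner_penalty qq h1 e0.
have [s2 hs2] := pos_corner_penalty pp h2 e0.
exists (Num.max 0 (Num.max s1 s2)) => s; rewrite !ge_max.
move=> /and3P[s0 /hs1 k1 /hs2 k2].
apply/(unorm_le _ _ u0); split.
  have := posD k1 (posZ s0 (pos_idem pp)); congr pos; rewrite /w /ray; lin.
have := posD k2 (posZ s0 (pos_idem qq)); congr pos; rewrite /w /ray; lin.
Qed.

Lemma horo_lipschitz a g w z : horo_rel p q a g ->
  g w <= g z + unorm A (w - z).
Proof.
move=> hg; have [h2 h1] := (hg z (g z)).1 (lexx _).
have [/(pos_Uquad qq) k1 /(pos_Uquad pp) k2] := unorm_pos (w - z) u0.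
have E1 : Uquad A q (unorm A (w - z) *: u - (w - z)) =
    unorm A (w - z) *: q - (Uquad A q w - Uquad A q z).
  by rewrite !UquadB UquadZ (Uquad1 qq).
have E2 : Uquad A p (unorm A (w - z) *: u + (w - z)) =
    unorm A (w - z) *: p + (Uquad A p w - Uquad A p z).
  by rewrite UquadD UquadB UquadZ (Uquad1 pp).
apply/hg; split.
  have := posD h2 k2; congr pos; rewrite E2 !UquadD; lin.
have := posD h1 k1; congr pos; rewrite E1 !UquadB; lin.
Qed.

Section Convergence.
Local Open Scope classical_set_scope.

Lemma hpoint_ray_cvg a (g : {ptws V -> R}) : horo_rel p q a g -> g 0 = 0 ->
  hpoint A (ray a s) @[s --> +oo] --> g.
Proof.
move=> hg g0; apply: cvg_ptws => z eps e0.
have e20 : 0 < eps / 2 by rewrite divr_gt0.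
have [s1 hs1] := horo_shift_ge z hg e20; have [s2 hs2] := horo_shift_ge 0 hg e20.
have := nbhs_pinfty_ge (num_real (Num.max s1 s2)).
move=> H; refine (filterS _ H) => s /=; rewrite ge_max => /andP[/hs1 k1 /hs2 k2].
have l1 := horo_shift_le hg (lexx (unorm A (z - ray a s))).
have l2 := horo_shift_le hg (lexx (unorm A (0 - ray a s))).
have h0 := hpoint_at0 (ray a s); move: h0 l1 l2 k1 k2; rewrite g0 /hpoint.
by move=> h0 l1 l2 k1 k2; rewrite ltr_norml; apply/andP; split; lra.
Qed.

Lemma horo_closure a (g : {ptws V -> R}) : horo_rel p q a g -> g 0 = 0 ->
  horo_compactification A g.
Proof.
move=> hg g0 W nW.
have H : (\forall s \near +oo%R, W (hpoint A (ray a s))).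
  exact: (hpoint_ray_cvg hg g0 nW).
have [s Ws] := filter_ex H.
exists (hpoint A (ray a s)); split; last exact: Ws.
by exists (ray a s).
Qed.

Lemma unormN x : unorm A (- x) = unorm A x.
Proof.
by have := hpoint_at0 x; rewrite /hpoint sub0r => /eqP; rewrite subr_eq0 => /eqP.
Qed.

(** For h_x within eps of g at the single point z, the Lipschitz bound gives ||x|| + g'(x) >= g'(z)
    - h_x(z) > g'(z) - g(z) - eps. *)
Lemma detour_cost_ge (g g' : {ptws V -> R}) z :
  (forall w x, g' w <= g' x + unorm A (w - x)) ->
  ((g' z - g z)%:E <= detour_cost A g g')%E.
Proof.
move=> lip; apply/lee_addgt0Pr => eps e0; rewrite -leeBlDr //.
apply: le_ereal_sup_tmp; pose W := [set f : {ptws V -> R} | `|f z - g z| < eps].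
exists (ereal_inf [set (unorm A x + g' x)%:E | x in hpoint A @^-1` W]).
  exists W => //; refine (@filterS _ (nbhs g) _ _ _ _ (nbhs_ptws g z e0)).
  by move=> f.
apply: le_ereal_inf_tmp => _ [x Wx <-]; rewrite -EFinB lee_fin.
have := lip z x; move: Wx; rewrite /W /hpoint /= ltr_norml => /andP[]; lra.
Qed.

Lemma detour_cost_le a b (g g' : {ptws V -> R}) : p + q != 0 ->
  horo_rel p q a g -> horo_rel p q b g' -> g 0 = 0 ->
  (detour_cost A g g' <= (maxeig A (p + q) (block (a - b)))%:E)%E.
Proof.
move=> pq0 hg hg' g0; apply: ge_ereal_sup => _ [W nW <-].
apply/lee_addgt0Pr => eps e0.
have nW' : nbhs g [set f | horo_compactification A f -> W f] by exact: nW.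
have H : (\forall s \near +oo%R, horo_compactification A (hpoint A (ray a s)) ->
    W (hpoint A (ray a s))).
  exact: (hpoint_ray_cvg hg g0 nW').
have [s1 hs1] := horo_shift_ge 0 hg e0.
have [s [Ws /hs1]] := filter_ex (filterI H (nbhs_pinfty_ge (num_real s1))).
rewrite sub0r unormN g0 add0r => hs.
apply: ge_ereal_inf; exists (unorm A (ray a s) + g' (ray a s))%:E.
  exists (ray a s) => //=; apply: Ws; apply: subset_closure.
  by exists (ray a s).
by rewrite (horo_ray _ _ pq0 hg') -EFinD lee_fin; lra.
Qed.

Lemma detour_costE a b (g g' : {ptws V -> R}) : p + q != 0 ->
  horo_rel p q a g -> horo_rel p q b g' -> g 0 = 0 ->
  detour_cost A g g' = (maxeig A (p + q) (block (a - b)))%:E.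
Proof.
move=> pq0 hg hg' g0; apply/eqP; rewrite eq_le detour_cost_le //=.
(* The start of the ray is an optimal test point: there g is at most 0, while g' already equals
   Lambda (a - b). *)
have gz : g (ray a 0) <= 0.
  rewrite (horo_ray _ _ pq0 hg) subr0 subrr block0.
  apply/maxeig_le; rewrite ?orth_idemD ?jmulx0 //.
  by rewrite scale0r subr0; exact: pos0.
have := detour_cost_ge g (ray a 0) (fun w x => horo_lipschitz w x hg').
rewrite (horo_ray _ _ pq0 hg'); apply: le_trans.
by rewrite lee_fin; lra.
Qed.

End Convergence.

End HoroRel.

Lemma horo_unbounded p q a (g : V -> R) : p • p = p -> q • q = q -> p • q = 0 ->
  p + q != 0 -> g 0 = 0 -> horo_rel p q a g -> forall s, g (s *: (p - q)) = - s.
Proof.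
move=> pp qq pq pq0 g0 hg s.
have {}g0 : maxeig A (p + q) (block p q (- a)) = 0.
  have := horo_ray pp qq pq 0 0 pq0 hg.
  by rewrite /ray scale0r !Uquadx0 subr0 addr0 g0 sub0r subr0.
have := horo_ray pp qq pq 0 s pq0 hg.
rewrite sub0r g0 sub0r /ray => <-; congr g.
by rewrite !Uquadx0 subr0 addr0.
Qed.

(** The function g is unbounded below, whereas h_y >= -||y||. *)
Lemma horo_not_hpoint p q a (g : V -> R) : p • p = p -> q • q = q -> p • q = 0 ->
  p + q != 0 -> u != 0 -> g 0 = 0 -> horo_rel p q a g -> forall y, g <> hpoint A y.
Proof.
move=> pp qq pq pq0 u0 g0 hg y gy; pose s := unorm A y + 1.
have := horo_unbounded pp qq pq pq0 g0 hg s; rewrite gy /hpoint.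
have := unorm_ge0 (s *: (p - q) - y) u0; rewrite /s; lra.
Qed.

(* Comparing the horofunctions along s (p - q) forces p' <= p and q' <= q. *)
Lemma horo_le_idem p q p' q' a b (g g' : V -> R) C :
  p • p = p -> q • q = q -> p • q = 0 -> p + q != 0 ->
  p' • p' = p' -> q' • q' = q' -> g 0 = 0 ->
  horo_rel p q a g -> horo_rel p' q' b g' -> (forall z, g' z <= g z + C) ->
  p • p' = p' /\ q • q' = q'.
Proof.
move=> pp qq pq pq0 pp' qq' g0 hg hg' hC.
have key s : pos A ((C - s) *: p' + s *: Uquad A p' (p - q) + Uquad A p' b) /\
    pos A ((C - s) *: q' - s *: Uquad A q' (p - q) + Uquad A q' b).
  have /hg'[h1 h2] : g' (s *: (p - q)) <= C - s.
    have := hC (s *: (p - q)); rewrite (horo_unbounded pp qq pq pq0 g0 hg); lra.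
  split.
    by move: h1; rewrite UquadD UquadZ addrA.
  by move: h2; rewrite (UquadB A _ _ b) UquadZ opprB addrA addrAC.
(* Dividing by s and letting s grow keeps only the leading coefficient of an affine family in the
   cone. *)
have lim x y : (forall s, 0 <= s -> pos A (s *: x + y)) -> pos A x.
  move=> h; apply: (@pos_archimedean _ _ A x y) => eps e0.
  have := posZ (ltW e0) (h eps^-1 _); rewrite invr_ge0 ltW // => /(_ isT).
  by rewrite scalerDr scalerA divff ?gt_eqF ?scale1r.
have h1 : pos A (Uquad A p' (p - q) - p').
  apply: (lim _ (C *: p' + Uquad A p' b)) => s _.
  by have [+ _] := key s; congr pos; lin.
have h2 : pos A (Uquad A q' (q - p) - q').
  apply: (lim _ (C *: q' + Uquad A q' b)) => s _.
  have [_ +] := key s; congr pos; rewrite !UquadB; lin.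
(* Pairing with e' gives <e', e> >= <e', e'> + <e', f> >= <e', u>. Hence <e', u - e> <= 0, which for
   idempotents forces orthogonality. *)
have aux e f e' : e • e = e -> f • f = f -> e' • e' = e' ->
    pos A (Uquad A e' (e - f) - e') -> e • e' = e'.
  move=> ee ff ee' h.
  have : <| e', u - e |> <= 0.
    have := pos_dot_idem h ee'; have := pos_dot_idem (pos_idem ff) ee'.
    rewrite (jdotDl A (Uquad A e' (e - f))) (Uquad_selfadj ee') (Uquad_id ee') //.
    rewrite !jdotE.
    rewrite (jdotC A e' u) (jdotC A e' e).
    have -> : <|u, e'|> = <|e', e'|> by rewrite -{1}ee' -jdot_jmulA jmul1x.
    lra.
  move=> h'; have := idem_orth ee' (idem_compl ee) h'.
  by rewrite jmulDl jmulNl jmul1x => /eqP; rewrite subr_eq0 => /eqP.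
by split; [exact: aux h1|exact: aux h2].
Qed.

End Horofunctions.

(** * The order-unit norm through cone inequalities *)

Section OrderUnitNorm.
Context (R : realType) (V : vectType R) (A : euclidean_jordan_algebra V).
Implicit Types (x y z w e c p q v : V) (s t : R).

Local Notation "x • y" := (jmul A x y) (at level 40, left associativity).
Local Notation u := (jone A).
Local Notation "<| x , y |>" := (jdot A x y) (at level 0, x, y at level 99).
Local Ltac lin := apply: (jdot_inj (A := A)) => ?; rewrite ?jdotE; ring.

Definition obound s x := pos A (s *: u - x) /\ pos A (s *: u + x).

Lemma oboundD s t x y : obound s x -> obound t y -> obound (s + t) (x + y).
Proof.
move=> [h1 h2] [k1 k2]; split.
  by have := posD h1 k1; congr pos; lin.
by have := posD h2 k2; congr pos; lin.
Qed.

Lemma oboundN s x : obound s x -> obound s (- x).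
Proof. by move=> [h1 h2]; split; rewrite ?opprK. Qed.

Lemma oboundZ s t x : obound s x -> obound (`|t| * s) (t *: x).
Proof.
move=> [h1 h2]; have [t0|t0] := ger0P t.
  by split; [have := posZ t0 h1|have := posZ t0 h2]; congr pos; lin.
have {}t0 : 0 <= - t by lra.
by split; [have := posZ t0 h2|have := posZ t0 h1]; congr pos; lin.
Qed.

Lemma obound_le s t x : s <= t -> obound s x -> obound t x.
Proof.
move=> st [h1 h2]; have k := posZ (_ : 0 <= t - s) (pos_idem (one_idem A)).
rewrite subr_ge0 in k; have {}k := k st.
by split; [have := posD h1 k|have := posD h2 k]; congr pos; lin.
Qed.

Lemma obound_sqr s x : obound s x -> pos A ((s ^+ 2) *: u - x • x).
Proof.
have [n [l [c [rc xE]]]] := spectral_theorem (one_idem A) (jmul1x A x).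
rewrite /obound xE (resolution_mul rc) !(resolution_subl rc) (resolution_addl rc).
move=> [h1 h2]; apply: (pos_resolution rc) => i; move: h1 h2.
have ci : c i • c i = c i by case: rc.
move=> /pos_dot_idem/(_ ci) + /pos_dot_idem/(_ ci).
rewrite !(resolution_dot rc) !pmulr_lge0; try exact: resolution_dot_gt0 rc _.
by move=> h1 h2; have := mulr_ge0 h1 h2; rewrite expr2; lra.
Qed.

(** Submultiplicativity by polarization: rescale x and y to a common bound s t, then bound 4 x y =
    (x + y)² - (x - y)² using that the sum and difference have squares at most (2 s t)² u. *)
Lemma oboundM s t x y : 0 < s -> 0 < t -> obound s x -> obound t y ->
  obound (s * t) (x • y).
Proof.
move=> s0 t0 hx hy; have st : 0 < s * t by rewrite mulr_gt0.
have {}hx : obound (s * t) (t *: x).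
  by have := oboundZ t hx; rewrite gtr0_norm // mulrC.
have {}hy : obound (s * t) (s *: y).
  by have := oboundZ s hy; rewrite gtr0_norm.
have k1 := obound_sqr (oboundD hx hy).
have k2 := obound_sqr (oboundD hx (oboundN hy)).
have c0 : 0 <= (4 * (s * t))^-1 by rewrite invr_ge0 mulr_ge0 // ltW.
have cE : (4 * (s * t))^-1 * (4 * (s * t)) = 1 by rewrite mulVf ?gt_eqF ?mulr_gt0.
move: {hx hy} (4 * (s * t))^-1 c0 cE => K c0 cE.
have E (r : R) : r = K * (4 * (s * t)) * r.
  by rewrite cE mul1r.
split.
  have := posZ c0 (posD k1 (pos_sqr A (t *: x - s *: y))); congr pos.
  rewrite !jmulE (jmulC A y x); apply: (jdot_inj (A := A)) => w; rewrite !jdotE.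
  rewrite [RHS]E; ring.
have := posZ c0 (posD k2 (pos_sqr A (t *: x + s *: y))); congr pos.
rewrite !jmulE (jmulC A y x); apply: (jdot_inj (A := A)) => w; rewrite !jdotE.
rewrite [RHS]E; ring.
Qed.

Lemma obound_exists x : exists2 M, 0 < M & obound M x.
Proof.
have [M M0 hM] := pos_order_bound A x; exists (M + 1); first by rewrite ltr_wpDl.
by apply: obound_le hM; rewrite lerDl.
Qed.

Lemma obound_idem e : e • e = e -> obound 1 e.
Proof.
move=> ee; split; rewrite scale1r; first exact/pos_idem/idem_compl.
by apply: posD; apply: pos_idem => //; exact: one_idem.
Qed.

Lemma obound_dot_bound d : exists2 c, 0 <= c &
  forall M x, obound M x -> `|<|x, d|>| <= M * c.
Proof.
have [K K0 [d1 d2]] := obound_exists d; exists (K * <|u, u|>).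
  by rewrite mulr_ge0 ?jdot_ge0 // ltW.
move=> M x [x1 x2]; have := pos_dot x1 d1; have := pos_dot x1 d2.
have := pos_dot x2 d1; have := pos_dot x2 d2.
rewrite !jdotE => h1 h2 h3 h4.
by rewrite ler_norml; apply/andP; split; lra.
Qed.

(** The operator T x = sum of <x, b_i> b_i is injective and self-adjoint, so d_i = T^{-1} b_i is
    dual to the basis. It reduces limits in V to scalar ones. *)
Lemma dual_basis : exists n (b d : 'I_n -> V),
  forall x, x = \sum_(i < n) <|x, d i|> *: b i.
Proof.
pose b := vbasis {: V}; pose T x := \sum_(i < \dim {: V}) <|x, b`_i|> *: b`_i.
have TD s x y : T (s *: x + y) = s *: T x + T y.
  rewrite /T scaler_sumr -big_split; apply: eq_bigr => i _ /=.
  by rewrite jdotDl jdotZl scalerDl scalerA.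
pose TL := HB.pack_for {linear V -> V} T (GRing.isLinear.Build R V V *:%R T TD).
have Tsa x y : <|T x, y|> = <|x, T y|>.
  rewrite jdot_suml jdotC jdot_suml; apply: eq_bigr => i _.
  by rewrite !jdotZl mulrC (jdotC A x) (jdotC A _ y) mulrC.
have kerT : lker (linfun TL) == 0%VS.
  apply/lker0P => x y; rewrite !lfunE /= => Txy.
  apply/eqP; rewrite -subr_eq0; set z := x - y.
  have Tz : T z = 0 by rewrite /z addrC -scaleN1r TD Txy scaleN1r addNr.
  have zb i : <|z, b`_i|> = 0.
    have [ib|] := ltnP i (size b); last by move/(nth_default 0) ->; rewrite jdotx0.
    have : \sum_(j < \dim {: V}) <|z, b`_j|> ^+ 2 = 0.
      transitivity <|T z, z|>; last by rewrite Tz jdot0x.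
      rewrite jdot_suml; apply: eq_bigr => j _.
      by rewrite jdotZl expr2 (jdotC A _ z).
    rewrite size_tuple in ib.
    move/psumr_eq0P => /(_ (fun _ _ => sqr_ge0 _)) /(_ (Ordinal ib) isT) /eqP.
    by rewrite sqrf_eq0 => /eqP.
  apply/eqP/(@jdot_eq0 _ _ A); rewrite {2}(coord_vbasis (memvf z)).
  rewrite jdotC jdot_suml big1 // => i _; by rewrite jdotZl jdotC zb mulr0.
pose S := ((linfun TL)^-1)%VF.
have TS x : T (S x) = x.
  have := lker0_lfunVK kerT x; by rewrite lfunE.
exists (\dim {: V}), (fun i => b`_i), (fun i => S b`_i) => x.
rewrite -{1}(TS x) /T; apply: eq_bigr => i _; congr (_ *: _).
by rewrite -{1}(TS b`_i) -Tsa TS.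
Qed.

End OrderUnitNorm.

(** * Limits along an ultrafilter *)

Section Ultralimits.
Context (R : realType) (V : vectType R) (A : euclidean_jordan_algebra V).
Implicit Types (x y z w e c p q v : V) (s t : R).

Local Notation "x • y" := (jmul A x y) (at level 40, left associativity).
Local Notation u := (jone A).
Local Notation "<| x , y |>" := (jdot A x y) (at level 0, x, y at level 99).
Local Ltac lin := apply: (jdot_inj (A := A)) => ?; rewrite ?jdotE; ring.

Section UltraLimits.
Context (T : Type) (G : set_system T) (UG : UltraFilter G).
Local Open Scope classical_set_scope.

Let PG : ProperFilter G. Proof. exact: ultra_proper. Qed.

(** The limit is the supremum of the t with t <= f on a set of G; the ultrafilter decides each
    threshold above it negatively. *)
Lemma ultra_scalar_lim (f : T -> R) M : G [set j | `|f j| <= M] ->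
  exists l, forall eps, 0 < eps -> G [set j | `|f j - l| <= eps].
Proof.
move=> hM; pose S := [set t | G [set j | t <= f j]].
have S0 : S (- M) by apply: filterS hM => j; rewrite /= ler_norml => /andP[].
have SM t : S t -> t <= M.
  move=> St; have [j [/= h1]] := filter_ex (filterI St hM).
  by rewrite ler_norml => /andP[_]; apply: le_trans.
have hS : has_sup S by split; [exists (- M)|exists M => t /SM].
exists (sup S) => eps e0; have [t St ht] := sup_adherent e0 hS.
have [Sn|Sn] := in_ultra_setVsetC [set j | sup S + eps <= f j] UG.
  have := sup_upper_bound hS (Sn : S (sup S + eps)); lra.
apply: filterS (filterI St Sn) => j /= [h1 /negP]; rewrite -ltNge => h2.
by rewrite ler_norml; apply/andP; split; lra.
Qed.

(** Convergence along [G] in the order-unit norm, written as cone inequalities so that it combines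
    directly with [posD] and [posZ]. *)
Definition vlim (F : T -> V) v := forall eps, 0 < eps ->
  G [set j | obound A eps (F j - v)].

Lemma vlim_cst v : vlim (fun _ => v) v.
Proof.
move=> eps e0; apply: filterE => j /=; rewrite subrr; split;
  rewrite ?subr0 ?addr0; apply: posZ (ltW e0) _; exact/pos_idem/one_idem.
Qed.

Lemma vlimD F H v w : vlim F v -> vlim H w -> vlim (fun j => F j + H j) (v + w).
Proof.
move=> hF hH eps e0; have e20 : 0 < eps / 2 by rewrite divr_gt0.
apply: filterS (filterI (hF _ e20) (hH _ e20)) => j [/= h1 h2].
have -> : F j + H j - (v + w) = (F j - v) + (H j - w) by lin.
by have := oboundD h1 h2; rewrite -splitr.
Qed.

Lemma vlim_sum n (F : 'I_n -> T -> V) (v : 'I_n -> V) :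
  (forall i, vlim (F i) (v i)) ->
  vlim (fun j => \sum_(i < n) F i j) (\sum_(i < n) v i).
Proof.
move=> h; elim: n F v h => [|n IH] F v h.
  move=> eps e0; apply: filterS (vlim_cst 0 e0) => j /=.
  by rewrite !big_ord0.
move=> eps e0; have := vlimD (h ord0) (IH _ _ (fun i => h (lift ord0 i))) e0.
by apply: filterS => j /=; rewrite !big_ord_recl.
Qed.

Lemma vlim_bounded F v : vlim F v -> exists2 M, 0 < M & G [set j | obound A M (F j)].
Proof.
move=> hF; have [M M0 hM] := obound_exists A v; exists (1 + M).
  by rewrite addr_gt0.
apply: filterS (hF 1 ltr01) => j /= h1.
by rewrite -(subrK v (F j)); apply: oboundD.
Qed.

Lemma vlimM F H v w : vlim F v -> vlim H w -> vlim (fun j => F j • H j) (v • w).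
Proof.
move=> hF hH eps e0; have [M M0 hM] := vlim_bounded hH.
have [N N0 hN] := obound_exists A v.
pose d := eps / (M + N); have MN : 0 < M + N by rewrite addr_gt0.
have d0 : 0 < d by rewrite divr_gt0.
apply: filterS (filterI hM (filterI (hF d d0) (hH d d0))) => j /= [k1 [k2 k3]].
have -> : F j • H j - v • w = (F j - v) • H j + v • (H j - w).
  rewrite !jmulE; lin.
have := oboundD (oboundM d0 M0 k2 k1) (oboundM N0 d0 hN k3).
by rewrite (mulrC N) -mulrDr /d mulfVK ?gt_eqF.
Qed.

Lemma vlimZ s F v : vlim F v -> vlim (fun j => s *: F j) (s *: v).
Proof.
move=> hF eps e0; have := vlimM (vlim_cst (s *: u)) hF e0.
by apply: filterS => j /=; rewrite !jmulZl !jmul1x.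
Qed.

Lemma vlimN F v : vlim F v -> vlim (fun j => - F j) (- v).
Proof.
move=> hF eps e0; have := vlimZ (-1) hF e0.
by apply: filterS => j /=; rewrite !scaleN1r.
Qed.

Lemma vlim_pos F v : vlim F v -> G [set j | pos A (F j)] -> pos A v.
Proof.
move=> hF hp; apply: (@pos_archimedean _ _ A v u) => eps e0.
have [j [/= p1 [p2 _]]] := filter_ex (filterI hp (hF _ e0)).
have := posD p1 p2; congr pos; lin.
Qed.

Lemma vlim_unique F v w : vlim F v -> vlim F w -> v = w.
Proof.
have le v' w' : vlim F v' -> vlim F w' -> pos A (v' - w').
  move=> hv hw; apply: (vlim_pos (vlimD hv (vlimN hw))).
  by apply: filterE => j /=; rewrite subrr; apply: pos0.
move=> hv hw; apply/eqP; rewrite -subr_eq0; apply/eqP/(pos_antisym (le _ _ hv hw)).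
by rewrite opprB; apply: le.
Qed.

Lemma vlim_ext F H v : G [set j | F j = H j] -> vlim F v -> vlim H v.
Proof.
move=> FH hF eps e0; apply: filterS (filterI FH (hF _ e0)) => j /= [<-].
exact.
Qed.

Lemma vlim_exists F M : G [set j | obound A M (F j)] -> exists v, vlim F v.
Proof.
move=> hM; have [n [b [d E]]] := dual_basis A.
have hl i : exists l, forall eps, 0 < eps ->
    G [set j | `|<|F j, d i|> - l| <= eps].
  have [c c0 hc] := obound_dot_bound A (d i).
  by apply: (@ultra_scalar_lim _ (M * c)); apply: filterS hM => j /= /hc.
have [l hl'] := choice hl; exists (\sum_(i < n) l i *: b i).
apply: (@vlim_ext (fun j => \sum_(i < n) <|F j, d i|> *: b i)).
  by apply: filterE => j /=; rewrite -E.
apply: vlim_sum => i eps e0; have [K K0 hK] := obound_exists A (b i).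
have eK : 0 < eps / K by rewrite divr_gt0.
apply: filterS (hl' i _ eK) => j /= hy; rewrite -scalerBl.
by apply: obound_le (oboundZ _ hK); rewrite -ler_pdivlMr.
Qed.

Lemma vlimU F H v w : vlim F v -> vlim H w ->
  vlim (fun j => Uquad A (F j) (H j)) (Uquad A v w).
Proof.
move=> hF hH; apply: vlimD.
  by apply: vlimZ; apply: vlimM hF (vlimM hF hH).
by apply: vlimN; apply: vlimM (vlimM hF hF) hH.
Qed.

End UltraLimits.

Section Calculus.

(* [Phi f] stands for f(x). *)
Record calculus x (Phi : (R -> R) -> V) : Prop := Calculus {
  calcD : forall f g, Phi (fun t => f t + g t) = Phi f + Phi g;
  calcZ : forall s f, Phi (fun t => s * f t) = s *: Phi f;
  calcM : forall f g, Phi (fun t => f t * g t) = Phi f • Phi g;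
  calc1 : Phi (fun _ => 1) = u;
  calc_id : Phi id = x;
  calc_pos : forall f, (forall t, 0 <= f t) -> pos A (Phi f) }.

Lemma calculus_exists x : exists Phi, calculus x Phi.
Proof.
have [n [l [c [rc xE]]]] := spectral_theorem (one_idem A) (jmul1x A x).
exists (fun f => \sum_(i < n) f (l i) *: c i); split=> [f g|s f|f g||//|f f0].
- by rewrite -big_split; apply: eq_bigr => i _; rewrite scalerDl.
- by rewrite scaler_sumr; apply: eq_bigr => i _; rewrite scalerA.
- by rewrite (resolution_mul rc).
- by rewrite [RHS](resolution_unit rc).
- by apply: (pos_resolution rc).
Qed.

Lemma calculusN x Phi : calculus x Phi ->
  calculus (- x) (fun f => Phi (fun t => f (- t))).
Proof.
case=> cD cZ cM c1 cid cp; split=> //; last by move=> f f0; apply: cp.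
by rewrite -scaleN1r -cid -cZ; congr Phi; apply/funext => t; rewrite mulN1r.
Qed.

End Calculus.

End Ultralimits.

Section UltralimitCorner.
Context (R : realType) (V : vectType R) (A : euclidean_jordan_algebra V).
Implicit Types (x y z w e c p q v : V) (s t : R).

Local Notation "x • y" := (jmul A x y) (at level 40, left associativity).
Local Notation u := (jone A).
Local Notation "<| x , y |>" := (jdot A x y) (at level 0, x, y at level 99).
Local Ltac lin := apply: (jdot_inj (A := A)) => ?; rewrite ?jdotE; ring.

Section UltraCorner.
Local Open Scope classical_set_scope.
Context (T : Type) (G : set_system T) (UG : UltraFilter G).
Context (X : T -> V) (rho : T -> R) (Phi : T -> (R -> R) -> V).
Hypothesis calc : forall j, calculus A (X j) (Phi j).
Hypothesis X_ge : forall j, pos A (X j + rho j *: u).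

Let PG : ProperFilter G. Proof. exact: ultra_proper. Qed.

Let chi j (M t : R) : R := (t + rho j <= M)%R%:R.

(* The spectral projection of X + rho u on the interval [0, M]. *)
Definition cut j M := Phi j (chi j M).

Lemma cutM j M N : M <= N -> cut j N • cut j M = cut j M.
Proof.
move=> MN; rewrite -(calcM (calc j)); congr (Phi j); apply/funext => t.
rewrite /chi -natrM mulnb; congr (_%:R); congr nat_of_bool.
by case: (leP _ M) => h; rewrite ?andbF // (le_trans h MN).
Qed.

Lemma cut_idem j M : cut j M • cut j M = cut j M.
Proof. exact: cutM. Qed.

Lemma Uquad_cut j M :
  Uquad A (cut j M) (X j + rho j *: u) = Phi j (fun t => chi j M t * (t + rho j)).
Proof.
have [cD cZ cM c1 cid _] := calc j.
have -> : X j + rho j *: u = Phi j (fun t => t + rho j).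
  rewrite -c1 -cZ -{1}cid -cD; congr (Phi j); apply/funext => t.
  by rewrite mulr1.
rewrite (UquadE (cut_idem j M)) /cut -!cM.
have -> : (fun t => chi j M t * (chi j M t * (t + rho j))) =
    (fun t => chi j M t * (t + rho j)).
  apply/funext => t; rewrite /chi; case: (_ <= M); by rewrite ?mul1r ?mul0r.
lin.
Qed.

(** Take the largest k such that some cut has Peirce dimension at least k on a set of G, and let M0
    reach it. A larger M cannot raise the dimension along G, and nested idempotents of equal
    dimension agree. Thus for each fixed M, no eigenvalue lies in (M0, M] along G. *)
Lemma cut_stable : exists2 M0, 0 <= M0 &
  forall M, M0 <= M -> G [set j | cut j M = cut j M0].
Proof.
pose dim j M := \dim (peirce1_space A (cut j M)).
pose P k := `[< exists2 M, 0 <= M & G [set j | (k <= dim j M)%N] >].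
have P0 : exists k, P k.
  by exists 0%N; apply/asboolP; exists 0 => //; exact: filterE.
have PM k : P k -> (k <= \dim {: V})%N.
  move=> /asboolP[M _ /filter_ex[j /= hk]].
  by apply: leq_trans hk _; apply/dimvS/subvf.
case: (ex_maxnP P0 PM) => k /asboolP[M0 M00 hM0] kmax; exists M0 => // M MM0.
have [h|h] := in_ultra_setVsetC [set j | (k.+1 <= dim j M)%N] UG.
  have /kmax : P k.+1 by apply/asboolP; exists M => //; apply: le_trans MM0.
  by rewrite ltnn.
apply: filterS (filterI h hM0) => j /= [/negP]; rewrite -leqNgt => h1 h2.
apply: (peirce1_dim_eq (cut_idem j M) (cut_idem j M0) (cutM j MM0)).
exact: leq_trans h1 h2.
Qed.

(** Scalar inequality behind it: what remains after the cut vanishes at eigenvalues up to M and is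
    at least M above. *)
Lemma cut_residual j M : 
  pos A (X j + rho j *: u - Uquad A (cut j M) (X j + rho j *: u) -
         M *: (u - cut j M)).
Proof.
rewrite Uquad_cut; have [cD cZ cM c1 cid cp] := calc j.
have h : pos A (Phi j (fun t => (t + rho j * 1) +
    (-1) * (chi j M t * (t + rho j)) + (- M) * (1 + (-1) * chi j M t))).
  apply: cp => t; rewrite /chi; case: (leP (t + rho j) M) => [h|/ltW h] /=; lra.
by move: h; rewrite !(cD, cZ) c1 cid !scaleN1r scaleNr.
Qed.

Lemma cut_bounded j M : 0 <= M -> obound A M (Uquad A (cut j M) (X j + rho j *: u)).
Proof.
move=> M0; have pa := pos_Uquad (cut_idem j M) (X_ge j).
have pM : pos A (M *: u) by apply: posZ M0 _; exact/pos_idem/one_idem.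
split; last exact: posD.
rewrite Uquad_cut; have [cD cZ cM c1 cid cp] := calc j.
have h : pos A (Phi j (fun t => M * 1 + (-1) * (chi j M t * (t + rho j)))).
  apply: cp => t; rewrite /chi; case: (leP (t + rho j) M) => [h|/ltW h] /=; lra.
by move: h; rewrite cD !cZ c1 scaleN1r.
Qed.

(* Eigenvalues of X + rho u either stay bounded along G or tend to infinity:
   q and a are the limits of the spectral projection on the bounded ones and
   of the corresponding part of X + rho u. *)
Lemma ultra_corner : exists q a M0,
  [/\ q • q = q, q • a = a, vlim A G (cut ^~ M0) q,
      forall z s, G [set j | pos A (s *: u - z + (X j + rho j *: u))] ->
        pos A (s *: q - Uquad A q z + a) &
      forall z s eps, 0 < eps -> pos A (s *: q - Uquad A q z + a) ->
        G [set j | pos A ((s + eps) *: u - z + (X j + rho j *: u))]].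
Proof.
have [M0 M00 stab] := cut_stable; pose y j := X j + rho j *: u.
pose a_ j := Uquad A (cut j M0) (y j).
have [q hq] : exists q, vlim A G (cut ^~ M0) q.
  apply: (vlim_exists UG (M := 1)); apply: filterE => j.
  exact/obound_idem/cut_idem.
have [a ha] : exists a, vlim A G a_ a.
  apply: (vlim_exists UG (M := M0)); apply: filterE => j.
  exact: cut_bounded.
have qq : q • q = q.
  apply: (vlim_unique UG _ hq); apply: vlim_ext (vlimM UG hq hq) => //.
  by apply: filterE => j /=; rewrite cut_idem.
have qa : q • a = a.
  apply: (vlim_unique UG _ ha); apply: vlim_ext (vlimM UG hq ha) => //.
  apply: filterE => j /=; apply: jmul_Uquad; exact: cut_idem.
exists q, a, M0; split=> //.
- move=> z s hs; apply: (vlim_pos UG (F := fun j =>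
    s *: cut j M0 - Uquad A (cut j M0) z + a_ j)).
    apply: vlimD ha => //; apply: vlimD; first exact: vlimZ.
    by apply: vlimN => //; apply: vlimU => //; exact: vlim_cst.
  apply: filterS hs => j /= /(pos_Uquad (cut_idem j M0)); congr pos.
  rewrite (UquadD A _ _ (X j + _)) -/(y j) -/(a_ j) (UquadB _ _ (s *: u) z) UquadZ.
  by rewrite (Uquad1 (cut_idem j M0)).
- move=> z s eps e0 hp; have e20 : 0 < eps / 2 by rewrite divr_gt0.
  have Uq : Uquad A q (s *: u - z + a) = s *: q - Uquad A q z + a.
    by rewrite UquadD (Uquad_id qq qa) UquadB UquadZ (Uquad1 qq).
  rewrite -Uq in hp; have [m hm] := pos_corner_penalty qq hp e20.
  (* Half of eps feeds the penalty lemma at the limit [q], the other half pays for replacing [q] and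
     [a] by nearby cuts. Since m0 >= M0, the cut at m0 is the cut at M0 along G, so its residual
     supplies the penalty m0 (u - cut). *)
  pose m0 := Num.max m M0; have {hm} := hm m0 _.
  rewrite le_max lexx => /(_ isT) hm.
  have hF : vlim A G (fun j => s *: u - z + a_ j + m0 *: (u - cut j M0))
      (s *: u - z + a + m0 *: (u - q)).
    apply: (vlimD UG); first by apply: (vlimD UG) => //; exact: vlim_cst.
    apply: (vlimZ UG); apply: (vlimD UG); first exact: vlim_cst.
    exact: vlimN.
  have MM0 : M0 <= m0 by rewrite le_max lexx orbT.
  apply: filterS (filterI (stab _ MM0) (hF _ e20)) => j /= [Ej [_ k]].
  have := cut_residual j m0; rewrite Ej => k'.
  have := posD (posD k k') hm; congr pos; rewrite -/(y j) -/(a_ j).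
  apply: (jdot_inj (A := A)) => w; rewrite !jdotE; lra.
Qed.

End UltraCorner.

End UltralimitCorner.

(** * Horofunctions and their parts *)

Section Classification.
Context (R : realType) (V : vectType R) (A : euclidean_jordan_algebra V).
Implicit Types (x y z w e c p q v : V) (s t : R).

Local Notation "x • y" := (jmul A x y) (at level 40, left associativity).
Local Notation u := (jone A).
Local Notation "<| x , y |>" := (jdot A x y) (at level 0, x, y at level 99).
Local Ltac lin := apply: (jdot_inj (A := A)) => ?; rewrite ?jdotE; ring.

Local Open Scope classical_set_scope.

Lemma unorm_le_add x y s : u != 0 -> obound A s y ->
  unorm A (x + y) <= unorm A x + s.
Proof.
move=> u0 ys; apply/(unorm_le _ _ u0); apply: oboundD ys.
exact: (unorm_pos x u0).
Qed.

(** The preimages of neighbourhoods of g generate a proper filter on V because g lies in the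
    closure; any ultrafilter above it works. *)
Lemma horofunction_ultra (g : {ptws V -> R}) : horo_compactification A g ->
  exists2 G : set_system V, UltraFilter G &
    forall z eps, 0 < eps -> G [set y | `|hpoint A y z - g z| < eps].
Proof.
move=> hg; pose F := filter_from (nbhs g) (fun W => hpoint A @^-1` W).
have FF : ProperFilter F.
  apply: filter_from_proper; first apply: filter_from_filter.
  - by exists setT; exact: filterT.
  - by move=> W W' nW nW'; exists (W `&` W') => //; exact: filterI.
  - by move=> W /hg[_ [[y _ <-] Wy]]; exists y.
have [G [UG FG]] := ultraFilterLemma FF; exists G => // z eps e0.
apply: FG; exists [set f : {ptws V -> R} | `|f z - g z| < eps] => //.
exact: nbhs_ptws.
Qed.

Theorem horofunction_rel (g : {ptws V -> R}) : u != 0 -> horofunction A g ->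
  exists p q a,
    [/\ p • p = p, q • q = q, p • q = 0, p + q != 0 & horo_rel A p q a g].
Proof.
move=> u0 [hg ng]; have [G UG hG] := horofunction_ultra hg.
have PG : ProperFilter G by exact: ultra_proper.
pose r y := unorm A y.
(* If the norms stayed below K on a set of G, y would converge to some y0 along G and g would be
   h_{y0}, which a horofunction is not. *)
have r_big K : G [set y | K < r y].
  have [//|h] := in_ultra_setVsetC [set y | K < r y] UG.
  exfalso; apply: ng.
  have [y0 hy0] : exists y0, vlim A G id y0.
    apply: (vlim_exists UG (M := K)); apply: filterS h => y /= /negP.
    by rewrite -leNgt => /(unorm_le _ _ u0).
  exists y0 => //; apply/funext => z; apply/eqP; rewrite -subr_eq0 -normr_le0.
  apply/ler_addgt0Pr => eps e0; have e30 : 0 < eps / 3 by rewrite divr_gt0.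
  have [y [/= b1 b2]] := filter_ex (filterI (hy0 _ e30) (hG z _ e30)).
  have k1 := unorm_le_add (z - y) u0 b1.
  have k2 := unorm_le_add (z - y0) u0 (oboundN b1).
  have k3 := unorm_le_add y0 u0 b1.
  have k4 := unorm_le_add y u0 (oboundN b1).
  have E1 : z - y + (y - y0) = z - y0 by lin.
  have E2 : z - y0 - (y - y0) = z - y by lin.
  have E3 : y0 + (y - y0) = y by lin.
  have E4 : y - (y - y0) = y0 by lin.
  rewrite E1 in k1; rewrite E2 in k2; rewrite E3 in k3; rewrite E4 in k4.
  move: b2; rewrite /hpoint ltr_norml add0r ler_norml => /andP[c1 c2].
  by apply/andP; split; lra.
have [Phi hPhi] := choice (calculus_exists A).
pose Psi y f := Phi y (fun t => f (- t)).
have hPsi y : calculus A (- y) (Psi y) := calculusN (hPhi y).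
have r_le y : pos A (y + r y *: u) /\ pos A (- y + r y *: u).
  have [h1 h2] := unorm_pos y u0; split.
    by move: h2; rewrite addrC.
  by move: h1; rewrite addrC.
have [q [a [M [qq qa hq q1 q2]]]] := ultra_corner UG hPhi (fun y => (r_le y).1).
have [p [b [N [pp pb hp p1 p2]]]] := ultra_corner UG hPsi (fun y => (r_le y).2).
(* An eigenvalue t of y selected by both cuts has r - t <= N and r + t <= M, hence 2 r <= M + N,
   impossible once r > M + N. *)
have pq : p • q = 0.
  apply: (vlim_unique UG _ (vlim_cst A UG 0)).
  apply: vlim_ext (vlimM UG hp hq); apply: filterS (r_big (M + N)) => y /=.
  have r0 := unorm_ge0 y u0 => hr.
  rewrite -/(r y) in r0; rewrite /cut /Psi -(calcM (hPhi y)).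
  transitivity (Phi y (fun t => 0 * 1)); last by rewrite (calcZ (hPhi y)) scale0r.
  congr (Phi y); apply/funext => t; rewrite mul0r -natrM mulnb.
  case: (leP (- t + r y) N) => // h1; case: (leP (t + r y) M) => // h2.
  by have : 0 < 0 :> R; [lra|rewrite ltxx].
have qp : q • p = 0 by rewrite jmulC.
have hg' : horo_rel A p q (b + a) g.
  have Up : Uquad A p (b + a) = b.
    by rewrite UquadD (Uquad_id pp pb) -(Uquad_id qq qa) (Uquad_orth pp qq pq)
      addr0.
  have Uq : Uquad A q (b + a) = a.
    by rewrite UquadD (Uquad_id qq qa) -(Uquad_id pp pb) (Uquad_orth qq pp qp) add0r.
  have Ep z s : s *: p + Uquad A p (z + (b + a)) = s *: p - Uquad A p (- z) + b.
    by rewrite UquadD Up UquadN opprK addrA.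
  have Eq z s : s *: q - Uquad A q (z - (b + a)) = s *: q - Uquad A q z + a.
    by rewrite UquadB Uq opprB addrA addrAC.
  move=> z t; rewrite Ep Eq; split=> [gt_|[h1 h2]].
    have H eps : 0 < eps -> G [set y | unorm A (z - y) <= t + eps + r y].
      move=> e0; apply: filterS (hG z eps e0) => y.
      by rewrite /= /hpoint ltr_norml => /andP[_]; rewrite -/(r y); lra.
    split.
      apply: (@pos_archimedean _ _ A _ p) => eps e0.
      suff: pos A ((t + eps) *: p - Uquad A p (- z) + b) by congr pos; lin.
      apply: p1; apply: filterS (H _ e0) => y /= /(unorm_le _ _ u0)[_].
      congr pos; lin.
    apply: (@pos_archimedean _ _ A _ q) => eps e0.
    suff: pos A ((t + eps) *: q - Uquad A q z + a) by congr pos; lin.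
    apply: q1; apply: filterS (H _ e0) => y /= /(unorm_le _ _ u0)[+ _].
    congr pos; lin.
  apply/ler_addgt0Pr => eps e0; have e20 : 0 < eps / 2 by rewrite divr_gt0.
  have [y [/= k1 [k2 k3]]] :=
    filter_ex (filterI (hG z _ e20) (filterI (p2 _ _ _ e20 h1) (q2 _ _ _ e20 h2))).
  have : unorm A (z - y) <= t + eps / 2 + r y.
    apply/(unorm_le _ _ u0); split.
      by move: k3; congr pos; lin.
    by move: k2; congr pos; lin.
  move: k1; rewrite /hpoint -/(r y) ltr_norml => /andP[]; lra.
(* With p = q = 0 the cone conditions hold for every t, and the relation would give g 0 <= g 0 -
   1. *)
exists p, q, (b + a); split=> //; apply/eqP => pq0.
have p0 : p = 0 by have := congr1 (jmul A p) pq0; rewrite jmulDr pp pq addr0 jmulx0.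
have q0 : q = 0 by have := congr1 (jmul A q) pq0; rewrite jmulDr qq qp add0r jmulx0.
have := (hg' 0 (g 0 - 1)).2; rewrite p0 q0 !scaler0 !Uquad0 subr0 addr0.
by move=> /(_ (conj (pos0 A) (pos0 A))); lra.
Qed.

Lemma blockB p q a b : block A p q (a - b) = block A p q a - block A p q b.
Proof. rewrite /block !UquadB; lin. Qed.

Lemma detour_distE p q a b (g g' : {ptws V -> R}) :
  p • p = p -> q • q = q -> p • q = 0 -> p + q != 0 -> u != 0 ->
  horo_rel A p q a g -> horo_rel A p q b g' -> g 0 = 0 -> g' 0 = 0 ->
  detour_dist A g g' = (varnorm A (p + q) (block A p q (a - b)))%:E.
Proof.
move=> pp qq pq pq0 u0 hg hg' g0 g0'.
rewrite /detour_dist /varnorm blockB opprB -blockB -blockB.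
rewrite (detour_costE pp qq pq u0 pq0 hg hg' g0).
by rewrite (detour_costE pp qq pq u0 pq0 hg' hg g0').
Qed.

Lemma same_partE p q p' q' a b (g g' : {ptws V -> R}) :
  p • p = p -> q • q = q -> p • q = 0 -> p + q != 0 ->
  p' • p' = p' -> q' • q' = q' -> p' • q' = 0 -> p' + q' != 0 -> u != 0 ->
  horo_rel A p q a g -> horo_rel A p' q' b g' -> g 0 = 0 -> g' 0 = 0 ->
  same_part A g g' <-> p = p' /\ q = q'.
Proof.
move=> pp qq pq pq0 pp' qq' pq' pq0' u0 hg hg' g0 g0'.
split=> [sp|[Ep Eq]]; last first.
  subst p' q'; rewrite /same_part (detour_distE pp qq pq pq0 u0 hg hg') //.
  exact: ltry.
have lip w x := horo_lipschitz pp qq u0 w x hg.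
have lip' w x := horo_lipschitz pp' qq' u0 w x hg'.
(* Nonnegativity excludes a cost of -oo, which could hide an infinite one in the sum; finiteness of
   the distance then makes both costs finite. *)
have c0 : (0%:E <= detour_cost A g g')%E.
  by have := detour_cost_ge g 0 lip'; rewrite g0 g0' subrr.
have c0' : (0%:E <= detour_cost A g' g)%E.
  by have := detour_cost_ge g' 0 lip; rewrite g0 g0' subrr.
move: sp; rewrite /same_part /detour_dist.
have := detour_cost_ge g _ lip'; have := detour_cost_ge g' _ lip.
move: (detour_cost A g g') (detour_cost A g' g) c0 c0' => [c||] [c'||] //= _ _.
move=> h1 h2 _.
have k1 z : g' z <= g z + c by have := h2 z; rewrite lee_fin; lra.
have k2 z : g z <= g' z + c' by have := h1 z; rewrite lee_fin; lra.
have [e1 e2] := horo_le_idem pp qq pq pq0 pp' qq' g0 hg hg' k1.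
have [e3 e4] := horo_le_idem pp' qq' pq' pq0' pp qq g0' hg' hg k2.
by split; [rewrite -e3 jmulC|rewrite -e4 jmulC].
Qed.


End Classification.

(** * The variation metric on a part *)

Section PartsAndFrames.
Context (R : realType) (V : vectType R) (A : euclidean_jordan_algebra V).
Implicit Types (x y z w e c p q v : V) (s t : R).

Local Notation "x • y" := (jmul A x y) (at level 40, left associativity).
Local Notation u := (jone A).
Local Notation "<| x , y |>" := (jdot A x y) (at level 0, x, y at level 99).
Local Ltac lin := apply: (jdot_inj (A := A)) => ?; rewrite ?jdotE; ring.

Section PartMetric.
Local Open Scope classical_set_scope.

Lemma maxeig_shift e x s : e • e = e -> e • x = x -> e != 0 ->
  maxeig A e (x + s *: e) = maxeig A e x + s.
Proof.
move=> ee ex e0; have exs : e • (x + s *: e) = x + s *: e.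
  by rewrite jmulDr jmulZr ex ee.
have P t : maxeig A e (x + s *: e) <= t <-> maxeig A e x <= t - s.
  have h1 := maxeig_le t ee exs e0; have h2 := maxeig_le (t - s) ee ex e0.
  rewrite h1 h2 (_ : t *: e - _ = (t - s) *: e - x); [exact: iff_refl|lin].
apply/eqP; rewrite eq_le; apply/andP; split; first by apply/P; rewrite addrK.
by rewrite -lerBrDr; apply/P.
Qed.

Lemma varnorm_shift e x s : e • e = e -> e • x = x -> e != 0 ->
  varnorm A e (x + s *: e) = varnorm A e x.
Proof.
move=> ee ex e0; rewrite /varnorm maxeig_shift //.
have -> : - (x + s *: e) = - x + (- s) *: e by lin.
by rewrite maxeig_shift ?jmulNr ?ex //; ring.
Qed.

(** [varnorm] is constant along R e, so the infimum over the difference of cosets is taken over a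
    single value. *)
Lemma quot_vardistE e x y : e • e = e -> e • x = x -> e • y = y -> e != 0 ->
  quot_vardist A e (line_coset e x) (line_coset e y) = varnorm A e (x - y).
Proof.
move=> ee ex ey e0; have exy : e • (x - y) = x - y.
  by rewrite jmulDr jmulNr ex ey.
rewrite /quot_vardist /quot_varnorm.
rewrite (_ : [set varnorm A e z | z in _] = [set varnorm A e (x - y)]) ?inf1 //.
apply/seteqP; split=> [_ [_ [_ [s _ <-] [_ [t _ <-] <-]] <-]|_ ->] /=.
  have -> : x + s *: e - (y + t *: e) = x - y + (s - t) *: e by lin.
  by rewrite varnorm_shift.
exists (x - y) => //; exists x; first by exists 0; rewrite ?scale0r ?addr0.
by exists y => //; exists 0; rewrite ?scale0r ?addr0.
Qed.

Section PartIsometry.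
Context (p q : V) (pp : p • p = p) (qq : q • q = q) (pq : p • q = 0).
Context (pq0 : p + q != 0) (u0 : u != 0).

Let ee := orth_idemD pp qq pq.

Lemma peirce_sum_block x : peirce_sum A p q x <-> block A p q x = x.
Proof.
split=> [[_ [y _ <-]] [_ [z _ <-] <-]|<-].
  rewrite /block !(UquadD A _ (Uquad A p y)) (Uquad_orth pp qq pq).
  rewrite (Uquad_orth qq pp (etrans (jmulC A q p) pq)) addr0 add0r.
  by rewrite (Uquad_id pp (jmul_Uquad pp y)) (Uquad_id qq (jmul_Uquad qq z)).
exists (Uquad A p x); first by exists x.
by exists (Uquad A q x) => //; exists x.
Qed.

(** One maximal eigenvalue in V(p, q), that of U_q (z - b) - U_p (z + b), realises the function,
    even when p or q is 0. *)
Lemma horo_rel_exists b : exists2 g : {ptws V -> R}, horo_rel A p q b g &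
  g 0 = maxeig A (p + q) (- block A p q b).
Proof.
pose c z := Uquad A q (z - b) - Uquad A p (z + b).
have bc z : block A p q (c z) = c z.
  apply/peirce_sum_block; exists (- Uquad A p (z + b)).
    by exists (- (z + b)) => //; rewrite UquadN.
  exists (Uquad A q (z - b)); first by exists (z - b).
  by rewrite addrC.
exists (fun z => maxeig A (p + q) (c z)); last first.
  by rewrite /c sub0r add0r UquadN; congr (maxeig _ _ _); rewrite /block; lin.
move=> z t; have ec : (p + q) • c z = c z by rewrite -bc block_mul.
have h1 := maxeig_le t ee ec pq0; have h2 := pos_block pp qq pq t (c z).
rewrite bc in h2; rewrite h1 h2.
have qp : q • p = 0 by rewrite jmulC.
have -> : Uquad A p (c z) = - Uquad A p (z + b).
  rewrite /c UquadB (Uquad_orth pp qq pq) sub0r Uquad_id //.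
  exact: jmul_Uquad.
have -> : Uquad A q (c z) = Uquad A q (z - b).
  rewrite /c UquadB (Uquad_orth qq pp qp) subr0 Uquad_id //.
  exact: jmul_Uquad.
by rewrite opprK.
Qed.

(** Evaluating g at the start of the ray of one datum, with respect to either datum, makes the
    difference of blocks positive; exchanging the data gives the opposite sign. *)
Lemma horo_rel_unique a b (g : V -> R) :
  horo_rel A p q a g -> horo_rel A p q b g -> block A p q a = block A p q b.
Proof.
have le a' b' : horo_rel A p q a' g -> horo_rel A p q b' g ->
    pos A (block A p q b' - block A p q a').
  move=> ha hb; have h1 := horo_ray pp qq pq a' 0 pq0 ha.
  have := horo_ray pp qq pq a' 0 pq0 hb; rewrite h1 !subr0 subrr block0 => h2.
  have e0 : (p + q) • 0 = 0 by rewrite jmulx0.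
  have z0 : maxeig A (p + q) 0 <= 0.
    by apply/(maxeig_le _ ee e0 pq0); rewrite scale0r subr0; exact: pos0.
  rewrite h2 in z0; move/(maxeig_le _ ee (block_mul pp qq pq _) pq0): z0.
  by rewrite scale0r sub0r blockB opprB.
move=> ha hb; apply/eqP; rewrite -subr_eq0; apply/eqP.
by apply: (pos_antisym (le _ _ hb ha)); rewrite opprB; exact: le.
Qed.

Lemma horo_rel_shift a b s (g g' : V -> R) : horo_rel A p q a g ->
  horo_rel A p q b g' -> block A p q a = block A p q b + s *: (p + q) ->
  forall z, g z = g' z - s.
Proof.
move=> ha hb E z; have qp : q • p = 0 by rewrite jmulC.
have Ep : Uquad A p a = Uquad A p b + s *: p.
  rewrite -(Uquadl_block pp qq pq a) E UquadD (Uquadl_block pp qq pq) UquadZ.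
  by rewrite UquadD (Uquad_id pp pp) (Uquad_eq0 pp pq) addr0.
have Eq : Uquad A q a = Uquad A q b + s *: q.
  rewrite -(Uquadr_block pp qq pq a) E UquadD (Uquadr_block pp qq pq) UquadZ.
  by rewrite UquadD (Uquad_id qq qq) (Uquad_eq0 qq qp) add0r.
have P t : g z <= t <-> g' z <= t + s.
  rewrite (ha z t) (hb z (t + s)) !(UquadD A p z) !(UquadB A q z) Ep Eq.
  rewrite (_ : t *: p + _ = (t + s) *: p + (Uquad A p z + Uquad A p b)); last lin.
  rewrite (_ : t *: q - _ = (t + s) *: q - (Uquad A q z - Uquad A q b)); last lin.
  exact: iff_refl.
apply/eqP; rewrite eq_le; apply/andP; split; first by apply/P; rewrite subrK.
by rewrite lerBlDr; apply/P.
Qed.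

Lemma horo_rel_horofunction a (g : {ptws V -> R}) : horo_rel A p q a g ->
  g 0 = 0 -> horofunction A g.
Proof.
move=> hg g0; split; first exact: (horo_closure pp qq pq u0 hg g0).
by move=> [y _ gy]; apply: (horo_not_hpoint pp qq pq pq0 u0 g0 hg (y := y)).
Qed.

Lemma part_isometric a (h : {ptws V -> R}) : horo_rel A p q a h -> h 0 = 0 ->
  isometric (part_of A h) (detour_dist A) (quot_space A p q)
    (quot_vardist A (p + q)).
Proof.
(* A member of the part is given only as a horofunction, so its datum is chosen, and
   [horofunction_rel] with [same_partE] guarantees that one exists for the same p, q. *)
move=> hh h0; pose sel (g : {ptws V -> R}) := xget 0 [set b | horo_rel A p q b g].
have part_rel g : part_of A h g -> horo_rel A p q (sel g) g /\ g 0 = 0.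
  move=> [hg sp]; have g0 : g 0 = 0 by apply: horo_at0 hg.1.
  split=> //; have [p' [q' [b [pp' qq' pq' pq0' hb]]]] := horofunction_rel u0 hg.
  have [E1 E2] := (same_partE pp qq pq pq0 pp' qq' pq' pq0' u0 hh hb h0 g0).1 sp.
  by apply: (@xgetPex _ 0 [set b | horo_rel A p q b g]); exists b; rewrite E1 E2.
exists (fun g => line_coset (p + q) (block A p q (sel g))); last first.
  move=> g g' /part_rel[hg g0] /part_rel[hg' g0'].
  rewrite (detour_distE pp qq pq pq0 u0 hg hg' g0 g0') //.
  rewrite quot_vardistE ?block_mul //; congr (varnorm _ _ _)%:E.
  exact: blockB.
split.
- move=> g _; exists (block A p q (sel g)) => //.
  exists (Uquad A p (sel g)); first by exists (sel g).
  by exists (Uquad A q (sel g)) => //; exists (sel g).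
- move=> g g' /set_mem/part_rel[hg g0] /set_mem/part_rel[hg' g0'] E.
  have : line_coset (p + q) (block A p q (sel g')) (block A p q (sel g)).
    by rewrite -E; exists 0; rewrite ?scale0r ?addr0.
  move=> [s _ /esym sE]; have D := horo_rel_shift hg hg' sE.
  have s0 : s = 0 by have := D 0; rewrite g0 g0'; lra.
  by apply/funext => z; rewrite D s0 subr0.
- move=> _ [x /peirce_sum_block bx <-].
  (* The representative of the coset for which g 0 = Lambda (-b) = 0, the normalisation at the
     basepoint. Uniqueness of the shift is what makes the map injective above. *)
  pose s := maxeig A (p + q) (- x); pose b := x + s *: (p + q).
  have qp : q • p = 0 by rewrite jmulC.
  have bb : block A p q b = b.
    rewrite /block /b !UquadD !UquadZ !UquadD (Uquad_id pp pp) (Uquad_eq0 pp pq).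
    rewrite (Uquad_eq0 qq qp) (Uquad_id qq qq) addr0 add0r -{3}bx /block.
    lin.
  have [g hg gE] := horo_rel_exists b.
  have g0 : g 0 = 0.
    rewrite gE bb /b (_ : - _ = - x + (- s) *: (p + q)); last lin.
    rewrite maxeig_shift ?subrr // jmulNr -bx block_mul //.
  have pg : part_of A h g.
    split; first exact: horo_rel_horofunction hg g0.
    exact: (same_partE pp qq pq pq0 pp qq pq pq0 u0 hh hg h0 g0).2.
  exists g => //; have [hg' _] := part_rel _ pg.
  rewrite (horo_rel_unique hg' hg) bb /b; apply/seteqP; split=> _ [t _ <-].
    by exists (s + t) => //; rewrite scalerDl addrA.
  by exists (t - s) => //; rewrite scalerBl; lin.
Qed.

End PartIsometry.

End PartMetric.

(** * Jordan frames as sources of orthogonal idempotent pairs *)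

Section Frames.
Context (r : nat) (p : 'I_r -> V) (hp : jordan_frame A p).

Lemma frame_mul_weighted (alpha : 'I_r -> R) (J : {set 'I_r}) i :
  p i • weighted_sum p alpha J = if i \in J then alpha i *: p i else 0.
Proof.
case: hp => prim orth _; rewrite /weighted_sum jmul_sumr; case: ifP => iJ.
  rewrite (bigD1 i) //= jmulZr big1 ?addr0 => [|j /andP[_ ji]].
    by case: (prim i) => ->.
  by rewrite jmulZr orth ?scaler0 // eq_sym.
rewrite big1 // => j jJ; rewrite jmulZr orth ?scaler0 //.
by apply: contraFneq iJ => ->.
Qed.

Lemma frame_sum_mul_weighted alpha I J :
  frame_sum p I • weighted_sum p alpha J = weighted_sum p alpha (I :&: J).
Proof.
rewrite /frame_sum jmul_suml; under eq_bigr do rewrite frame_mul_weighted //.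
by rewrite -big_mkcondr /=; apply: eq_bigl => i; rewrite inE.
Qed.

Lemma frame_sumE I : frame_sum p I = weighted_sum p (fun _ => 1) I.
Proof. by apply: eq_bigr => i _; rewrite scale1r. Qed.

Lemma frame_sum_mul I J : frame_sum p I • frame_sum p J = frame_sum p (I :&: J).
Proof. by rewrite !(frame_sumE J) frame_sum_mul_weighted -frame_sumE. Qed.

Lemma weighted_sum0 alpha : weighted_sum p alpha finset.set0 = 0.
Proof. by rewrite /weighted_sum big_set0. Qed.

Lemma frame_sum_eq0 I : frame_sum p I = 0 -> I = finset.set0.
Proof.
move=> pI0; apply/eqP/negPn/negP => /set0Pn[i iI].
have := frame_mul_weighted (fun _ => 1) I i; rewrite -frame_sumE pI0 iI.
rewrite jmulx0 scale1r => /esym pi0.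
by case: hp => prim _ _; case: (prim i).
Qed.

Context (I J : {set 'I_r}) (hIJ : [disjoint I & J]).
Context (hIJ0 : I :|: J != finset.set0).
Context (alpha : 'I_r -> R).

Let pI := frame_sum p I.
Let pJ := frame_sum p J.
Let wI := weighted_sum p alpha I.
Let wJ := weighted_sum p alpha J.

Lemma frame_blocks : [/\ pI • pI = pI, pJ • pJ = pJ, pI • pJ = 0 & pI + pJ != 0].
Proof.
have II : pI • pI = pI by rewrite /pI frame_sum_mul finset.setIid.
have JJ : pJ • pJ = pJ by rewrite /pJ frame_sum_mul finset.setIid.
have IJ : pI • pJ = 0.
  by rewrite /pI /pJ frame_sum_mul disjoint_setI0 // /frame_sum big_set0.
split=> //; apply: contra_neqN hIJ0 => /eqP E.
have /frame_sum_eq0 -> : pI = 0.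
  by have := congr1 (jmul A pI) E; rewrite jmulDr II IJ addr0 jmulx0.
have /frame_sum_eq0 -> : pJ = 0.
  have := congr1 (jmul A pJ) E; rewrite jmulDr (jmulC A _ pI) IJ JJ add0r.
  by rewrite jmulx0.
by rewrite finset.setU0.
Qed.

Lemma weighted_peirce : pI • wI = wI /\ pJ • wJ = wJ.
Proof. by rewrite /pI /wI /pJ /wJ !frame_sum_mul_weighted !finset.setIid. Qed.

(** The omitted term of an empty index set corresponds to a condition [pos 0], which always holds;
    this is where the case distinction in [horo_form] disappears. *)
Lemma horo_form_rel : horo_rel A pI pJ (wI + wJ) (horo_form A p I J alpha).
Proof.
have [II JJ IJ IJ0] := frame_blocks; have [wI1 wJ1] := weighted_peirce.
have JI : pJ • pI = 0 by rewrite jmulC.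
move=> z t.
have UI : Uquad A pI (z + (wI + wJ)) = Uquad A pI z + wI.
  rewrite !UquadD (Uquad_id II wI1) -(Uquad_id JJ wJ1) (Uquad_orth II JJ IJ).
  by rewrite addr0.
have UJ : Uquad A pJ (z - (wI + wJ)) = Uquad A pJ z - wJ.
  rewrite UquadB UquadD (Uquad_id JJ wJ1) -(Uquad_id II wI1).
  by rewrite (Uquad_orth JJ II JI) add0r.
rewrite UI UJ /horo_form -/pI -/pJ -/wI -/wJ.
have VI : pI • (- Uquad A pI z - wI) = - Uquad A pI z - wI.
  by rewrite jmulDr !jmulNr jmul_Uquad // wI1.
have VJ : pJ • (Uquad A pJ z - wJ) = Uquad A pJ z - wJ.
  by rewrite jmulDr !jmulNr jmul_Uquad // wJ1.
have hI : pI != 0 -> maxeig A pI (- Uquad A pI z - wI) <= t <->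
    pos A (t *: pI + (Uquad A pI z + wI)).
  by move=> n0; rewrite (maxeig_le t II VI n0) opprD !opprK.
have hJ n0 := maxeig_le t JJ VJ n0.
have nz K : K != finset.set0 -> frame_sum p K != 0.
  by apply: contra_neq => /frame_sum_eq0.
have [I0|I0] := eqVneq I finset.set0.
  have pI0 : pI = 0 by rewrite /pI I0 /frame_sum big_set0.
  have wI0 : wI = 0 by rewrite /wI I0 weighted_sum0.
  have J0 : J != finset.set0 by move: hIJ0; rewrite I0 finset.set0U.
  rewrite pI0 wI0 Uquad0 scaler0 !addr0 hJ ?nz //.
  by split=> [h|[]//]; split=> //; exact: pos0.
have [J0|J0] := eqVneq J finset.set0.
  have pJ0 : pJ = 0 by rewrite /pJ J0 /frame_sum big_set0.
  have wJ0 : wJ = 0 by rewrite /wJ J0 weighted_sum0.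
  rewrite pJ0 wJ0 Uquad0 scaler0 !subr0 hI ?nz //.
  by split=> [h|[]//]; split=> //; exact: pos0.
rewrite ge_max; split=> [/andP[/hI h1 /hJ h2]|[h1 h2]].
  by split; [apply: h1; exact: nz|apply: h2; exact: nz].
by apply/andP; split; [apply/hI|apply/hJ] => //; exact: nz.
Qed.

End Frames.

End PartsAndFrames.

Theorem theorem4p3 (R : realType) (V : vectType R)
  (A : euclidean_jordan_algebra V) (r : nat) (hr : has_rank A r)
  (h h' : {ptws V -> R}) (p q : 'I_r -> V) (I J I' J' : {set 'I_r})
  (alpha beta : 'I_r -> R)
  (hp : jordan_frame A p) (hq : jordan_frame A q)
  (hIJ : [disjoint I & J]) (hIJ0 : I :|: J != finset.set0)
  (hIJ' : [disjoint I' & J']) (hIJ0' : I' :|: J' != finset.set0)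
  (halpha : min_zero_on alpha (I :|: J))
  (hbeta : min_zero_on beta (I' :|: J'))
  (hh : horofunction A h) (hh' : horofunction A h')
  (hE : h = horo_form A p I J alpha) (hE' : h' = horo_form A q I' J' beta) :
  let pI := frame_sum p I in
  let pJ := frame_sum p J in
  let qI' := frame_sum q I' in
  let qJ' := frame_sum q J' in
  let pIJ := pI + pJ in
  let a := weighted_sum p alpha I + weighted_sum p alpha J in
  let b := weighted_sum q beta I' + weighted_sum q beta J' in
  [/\ same_part A h h' <-> (pI = qI' /\ pJ = qJ'),
      same_part A h h' ->
        [/\ peirce_sum A pI pJ a, peirce_sum A pI pJ b &
            detour_dist A h h' = (varnorm A pIJ (a - b))%:E] &
      isometric (part_of A h) (detour_dist A)
                (quot_space A pI pJ) (quot_vardist A pIJ)].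
Proof.
have [pp qq pq pq0] := frame_blocks hp hIJ hIJ0.
have [pp' qq' pq' pq0'] := frame_blocks hq hIJ' hIJ0'.
have [wI wJ] := weighted_peirce hp I J alpha.
have [wI' wJ'] := weighted_peirce hq I' J' beta.
move=> pI pJ qI' qJ' pIJ a b.
(* A zero unit would annihilate p_I + p_J, which is nonzero because I and J are not both empty. *)
have u0 : jone A != 0.
  apply: contraNneq pq0 => u0.
  by rewrite -(jmulx1 A (frame_sum p I + _)) u0 jmulx0.
have hg : horo_rel A pI pJ a h by rewrite hE; apply: horo_form_rel.
have hg' : horo_rel A qI' qJ' b h' by rewrite hE'; apply: horo_form_rel.
have h0 := horo_at0 hh.1; have h0' := horo_at0 hh'.1.
have SP := same_partE pp qq pq pq0 pp' qq' pq' pq0' u0 hg hg' h0 h0'.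
split=> //; last exact: part_isometric pp qq pq pq0 u0 _ _ hg h0.
move=> /SP[E1 E2].
have sa : peirce_sum A pI pJ a.
  exists (weighted_sum p alpha I).
    by exists (weighted_sum p alpha I); rewrite // (Uquad_id pp wI).
  exists (weighted_sum p alpha J) => //.
  by exists (weighted_sum p alpha J); rewrite // (Uquad_id qq wJ).
have sb : peirce_sum A pI pJ b.
  rewrite /pI /pJ E1 E2.
  exists (weighted_sum q beta I').
    by exists (weighted_sum q beta I'); rewrite // (Uquad_id pp' wI').
  exists (weighted_sum q beta J') => //.
  by exists (weighted_sum q beta J'); rewrite // (Uquad_id qq' wJ').
have {}hg' : horo_rel A pI pJ b h' by rewrite /pI /pJ E1 E2.
split=> //.
rewrite (detour_distE pp qq pq pq0 u0 hg hg' h0 h0'); congr (varnorm _ _ _)%:E.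
have /(peirce_sum_block pp qq pq) ba := sa.
have /(peirce_sum_block pp qq pq) bb := sb.
by rewrite blockB ba bb.
Qed.
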